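(* Let $n\in\mathbb{N}$, let $\mathcal{X}\subset\mathbb{R}^{n}$ be a convex and compact set containing the origin with $\mathrm{Vol}(\mathcal{X})>0$, let $\mathsf{H}\in\mathbb{R}^{n\times n}$ be of full rank, and let $$\rho(\mathcal{X},\mathsf{H}):=\frac{\mathrm{Vol}\bigl(\mathcal{B}_{\mathbf{0}}(r_{\mathsf{max}}(\mathsf{H}\mathcal{X}))\bigr)}{\mathrm{Vol}(\mathsf{H}\mathcal{X})}.$$ Then $$C(\mathcal{X},\mathsf{H})-\underline{C}_{\mathsf{EPI}}(\mathcal{X},\mathsf{H})\le\frac n2\log\left((\pi n)^{\frac1n}\rho(\mathcal{X},\mathsf{H})^{\frac2n}\right),$$ where $$\underline{C}_{\mathsf{EPI}}(\mathcal{X},\mathsf{H}):=\frac{n}{2}\log\left(1+\frac{|\det(\mathsf{H})|^{\frac2n}\,\mathrm{Vol}(\mathcal{X})^{\frac2n}}{2\pi e}\right).$$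
   Context: All logarithms are to base $2$; mutual information is measured in bits. The channel is $\mathbf{Y}=\mathsf{H}\mathbf{X}+\mathbf{Z}$, where $\mathbf{Z}\sim\mathcal{N}(\mathbf{0},\mathsf{I}_{n})$ is independent of the input $\mathbf{X}\in\mathbb{R}^{n}$. The capacity is $$C(\mathcal{X},\mathsf{H}):=\max_{F_{\mathbf{X}}:\mathbf{X}\in\mathcal{X}}I(\mathbf{X};\mathsf{H}\mathbf{X}+\mathbf{Z}),$$ the maximum being over all distributions $F_{\mathbf{X}}$ of random vectors $\mathbf{X}$ taking values in $\mathcal{X}$. $\mathsf{H}\mathcal{X}:=\{\mathsf{H}\mathbf{x}:\mathbf{x}\in\mathcal{X}\}$. $\mathrm{Vol}$ is Lebesgue measure on $\mathbb{R}^n$. $\mathcal{B}_{\mathbf{0}}(r)\subset\mathbb{R}^n$ is the closed Euclidean ball of radius $r$ centered at the origin, and $r_{\mathsf{max}}(\mathcal{S}):=\min\{r\ge 0:\mathcal{S}\subset\mathcal{B}_{\mathbf{0}}(r)\}$ for a set $\mathcal{S}\subset\mathbb{R}^n$ containing the origin. *)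

(* Defs.v *)
From HB Require Import structures.
From mathcomp Require Import all_boot all_order all_algebra.
From mathcomp Require Import all_classical all_reals all_analysis.
From mathcomp Require Import measurable_realfun.

Set Implicit Arguments.
Unset Strict Implicit.
Unset Printing Implicit Defensive.

Import Order.TTheory GRing.Theory Num.Theory.
Import numFieldNormedType.Exports.

Local Open Scope classical_set_scope.
Local Open Scope ring_scope.

Definition measure_cV_display : measure_display.
Proof. exact: default_measure_display. Qed.

(* R^n is 'cV[R]_n with the sigma-algebra generated by the n coordinates; it is
   the Borel sigma-algebra of the topology of 'cV[R]_n, since the latter is the
   product topology. *)
Section measurable_cV.
Context {R : realType} (n : nat).

Let coors : 'I_n -> 'cV[R]_n -> R := fun i x => x i ord0.

Let cV_set0 : g_sigma_preimage coors set0.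
Proof. exact: sigma_algebra0. Qed.

Let cV_setC A : g_sigma_preimage coors A -> g_sigma_preimage coors (~` A).
Proof. exact: sigma_algebraC. Qed.

Let cV_bigcup (F : _^nat) : (forall i, g_sigma_preimage coors (F i)) ->
  g_sigma_preimage coors (\bigcup_i (F i)).
Proof. exact: sigma_algebra_bigcup. Qed.

HB.instance Definition _ := @isMeasurable.Build measure_cV_display
  'cV[R]_n (g_sigma_preimage coors) cV_set0 cV_setC cV_bigcup.

End measurable_cV.

Section measurable_fun_cV.
Context {R : realType} {n : nat}.

Lemma measurable_coord (i : 'I_n) :
  measurable_fun [set: 'cV[R]_n] (fun x => x i ord0).
Proof.
move=> _ Y mY; rewrite setTI; apply: sub_sigma_algebra => /=.
rewrite -bigcup_seq/=; exists i => /=; first by rewrite mem_index_enum.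
by exists Y => //; rewrite setTI.
Qed.

Lemma measurable_fun_cV d (T : measurableType d) (f : T -> 'cV[R]_n) :
  (forall i, measurable_fun [set: T] (fun x => f x i ord0)) ->
  measurable_fun [set: T] f.
Proof.
move=> mf; suff prefS : g_sigma_preimage (fun i x => f x i ord0) `<=` measurable.
  move: prefS; rewrite (_ : (fun i x => f x i ord0) =
    (fun i => (fun x : 'cV[R]_n => x i ord0) \o f))// g_sigma_preimage_comp.
  by move=> prefS _ A mA; apply: prefS; exists A.
apply: smallest_sub; first exact: sigma_algebra_measurable.
case: n f mf => [|k] f mf; first by rewrite big_ord0.
rewrite -bigcup_mkord_ord; apply: bigcup_sub => i Ii.
by move=> A [B mB <-]; exact: mf.
Qed.

End measurable_fun_cV.

Section cons_cV.
Context {R : realType} {n : nat}.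

Definition cons_cV (p : measurableTypeR R * 'cV[R]_n) : 'cV[R]_n.+1 :=
  col_mx (const_mx p.1 : 'cV[R]_1) p.2.

Definition uncons_cV (x : 'cV[R]_n.+1) : measurableTypeR R * 'cV[R]_n :=
  (x ord0 ord0, dsubmx (x : 'cV[R]_(1 + n))).

Lemma cons_cVK : cancel cons_cV uncons_cV.
Proof.
move=> [r v]; rewrite /uncons_cV /cons_cV/= col_mxKd; congr pair.
rewrite [LHS](_ : _ = col_mx (const_mx r : 'cV_1) v (lshift n ord0) ord0).
  by rewrite col_mxEu mxE.
by congr (fun_of_matrix _ _ _); exact/val_inj.
Qed.

Lemma measurable_cons_cV : measurable_fun [set: measurableTypeR R * 'cV[R]_n] cons_cV.
Proof.
apply: measurable_fun_cV => i; case: (@split_ordP 1 n i) => j ->.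
  rewrite [X in measurable_fun _ X](_ : _ = fst); first exact: measurable_fst.
  by apply/funext => p; rewrite [LHS](@col_mxEu _ 1) mxE.
rewrite [X in measurable_fun _ X](_ : _ =
    fun p : measurableTypeR R * 'cV[R]_n => p.2 j ord0); last first.
  by apply/funext => p; rewrite [LHS](@col_mxEd _ 1).
exact: (measurableT_comp (measurable_coord j) measurable_snd).
Qed.

Lemma measurable_uncons_cV : measurable_fun [set: 'cV[R]_n.+1] uncons_cV.
Proof.
apply: measurable_fun_pair; first exact: measurable_coord.
apply: measurable_fun_cV => i; under eq_fun do rewrite mxE.
exact: measurable_coord.
Qed.

HB.instance Definition _ :=
  isMeasurableFun.Build _ _ _ _ cons_cV measurable_cons_cV.

End cons_cV.

Section vol.
Context {R : realType}.

Definition vol_cons n (mu : set 'cV[R]_n -> \bar R) : set 'cV[R]_n.+1 -> \bar R :=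
  pushforward (lebesgue_measure \x mu)%E cons_cV.

Section vol_cons.
Context {n : nat} (mu : {sigma_finite_measure set 'cV[R]_n -> \bar R}).

Let vol0 : vol_cons mu set0 = 0%E. Proof. exact: measure0. Qed.

Let vol_ge0 A : (0 <= vol_cons mu A)%E. Proof. exact: measure_ge0. Qed.

Let vol_sigma_additive : semi_sigma_additive (vol_cons mu).
Proof. exact: measure_semi_sigma_additive. Qed.

HB.instance Definition _ := isMeasure.Build _ _ _ (vol_cons mu)
  vol0 vol_ge0 vol_sigma_additive.

Let vol_sigma_finite : sigma_finite setT (vol_cons mu).
Proof.
have /sigma_finiteP[F [TF ndF mF]] :=
  sigma_finiteT (@lebesgue_measure R : {sigma_finite_measure set _ -> \bar R}).
have /sigma_finiteP[G [TG ndG mG]] := sigma_finiteT mu.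
exists (fun k => uncons_cV @^-1` (F k `*` G k)).
  rewrite -preimage_bigcup -[LHS](@preimage_setT _ _ uncons_cV); congr (_ @^-1` _).
  rewrite -setXTT TF TG predeqE => -[x y]; split.
    move=> [/= [a _ Fax] [b _ Gby]]; exists (maxn a b) => //; split.
    - by move: x Fax; exact/subsetPset/ndF/leq_maxl.
    - by move: y Gby; exact/subsetPset/ndG/leq_maxr.
  by move=> [a _ []/= ? ?]; split; exists a.
move=> k; have [mFk Fk] := mF k; have [mGk Gk] := mG k; split.
  rewrite -[X in measurable X]setTI.
  by apply: measurable_uncons_cV => //; exact: measurableX.
rewrite /vol_cons /pushforward -comp_preimage (_ : _ \o _ = id); last first.
  by apply/funext => p /=; rewrite cons_cVK.
by rewrite preimage_id product_measure1E// lte_mul_pinfty// ge0_fin_numE.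
Qed.

HB.instance Definition _ := Measure_isSigmaFinite.Build _ _ _ (vol_cons mu)
  vol_sigma_finite.

End vol_cons.

(* Lebesgue measure on R^n, as the n-fold product of lebesgue_measure. *)
Fixpoint vol n : {sigma_finite_measure set 'cV[R]_n -> \bar R} :=
  match n with
  | 0 => \d_(0 : 'cV[R]_0)
  | n'.+1 => vol_cons (vol n')
  end.

(* The law N(0, I_n) of n independent N(0, 1) coordinates. *)
Fixpoint std_gaussian n : probability 'cV[R]_n R :=
  match n with
  | 0 => \d_(0 : 'cV[R]_0)
  | n'.+1 => distribution (normal_prob 0 1 \x std_gaussian n')%E cons_cV
  end.

End vol.

Lemma preimage_cons_cV_rect {R : realType} n (A : 'I_n.+1 -> set R) :
  cons_cV @^-1` [set x | forall i, A i (x i ord0)] =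
  A ord0 `*` [set x : 'cV[R]_n | forall i, A (lift ord0 i) (x i ord0)].
Proof.
have c0 (p : measurableTypeR R * 'cV[R]_n) : cons_cV p ord0 ord0 = p.1.
  by rewrite -[in RHS](cons_cVK p).
have cS (p : measurableTypeR R * 'cV[R]_n) i :
    cons_cV p (lift ord0 i) ord0 = p.2 i ord0.
  rewrite -[in RHS](cons_cVK p) /uncons_cV [RHS]mxE.
  by congr (fun_of_matrix _ _ _); exact/val_inj.
apply/seteqP; split => p /= Ap.
  by split => [|i] /=; [rewrite -c0|rewrite -cS]; exact: Ap.
by move=> i; case: (unliftP ord0 i) => [j|] ->; [rewrite cS|rewrite c0];
  case: Ap.
Qed.

Lemma measurable_rect {R : realType} n (A : 'I_n -> set R) :
  (forall i, measurable (A i)) ->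
  measurable [set x : 'cV[R]_n | forall i, A i (x i ord0)].
Proof.
move=> mA; rewrite (_ : [set x | _] =
    \bigcap_(i in [set: 'I_n]) (fun x : 'cV[R]_n => x i ord0) @^-1` A i).
  apply: fin_bigcap_measurable => // i _; rewrite -[X in measurable X]setTI.
  exact: measurable_coord.
by apply/seteqP; split => x /= Ax i => [_|]; exact: Ax.
Qed.

Lemma vol_rect {R : realType} n (A : 'I_n -> set R) :
  (forall i, measurable (A i)) ->
  (vol n [set x : 'cV[R]_n | forall i, A i (x i ord0)] =
   \prod_(i < n) lebesgue_measure (A i))%E.
Proof.
elim: n A => [A _|n IH A mA].
  by rewrite big_ord0 /= diracE mem_set// => -[].
rewrite big_ord_recl -IH// -product_measure1E.
- exact: (congr1 (product_measure1 _ _) (preimage_cons_cV_rect A)).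
- exact: mA.
- exact: (@measurable_rect _ _ (fun i => A (lift ord0 i))).
Qed.

Lemma std_gaussian_rect {R : realType} n (A : 'I_n -> set R) :
  (forall i, measurable (A i)) ->
  (std_gaussian n [set x : 'cV[R]_n | forall i, A i (x i ord0)] =
   \prod_(i < n) normal_prob 0 1 (A i))%E.
Proof.
elim: n A => [A _|n IH A mA].
  by rewrite big_ord0 /= diracE mem_set// => -[].
rewrite big_ord_recl -IH// -product_measure1E.
- exact: (congr1 (product_measure1 _ _) (preimage_cons_cV_rect A)).
- exact: mA.
- exact: (@measurable_rect _ _ (fun i => A (lift ord0 i))).
Qed.

Section information.
Context {R : realType}.

Definition log2 (x : R) : R := ln x / ln 2.

(* Relative entropy in bits; the integral over P of log2 (dP/dQ) has an
   integrable negative part, so it is well defined in \bar R. *)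
Definition kl_divergence d (T : measurableType d) (P Q : probability T R) :
    \bar R :=
  if `[< P `<< Q >] then
    (\int[P]_x (log2 (fine (Radon_Nikodym (charge_of_finite_measure P) Q x)))%:E)%E
  else +oo%E.

Section mutual_information.
Context d d1 d2 (T : measurableType d) (T1 : measurableType d1)
  (T2 : measurableType d2) (P : probability T R).
Variables (X : {mfun T >-> T1}) (Y : {mfun T >-> T2}).

Definition pair_RV : T -> T1 * T2 := fun w => (X w, Y w).

Let measurable_pair_RV : measurable_fun [set: T] pair_RV.
Proof. by apply: measurable_fun_pair. Qed.

HB.instance Definition _ :=
  isMeasurableFun.Build _ _ _ _ pair_RV measurable_pair_RV.

Definition mutual_information : \bar R :=
  kl_divergence (distribution P pair_RV)
                (distribution P X \x distribution P Y)%E.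

End mutual_information.
End information.

Section channel.
Context {R : realType} {n : nat}.

(* The probability space is that of pairs p = (x, z), x being the input and z the
   noise; under the product measure they are independent. *)
Definition channel_input (p : 'cV[R]_n * 'cV[R]_n) : 'cV[R]_n := p.1.

Definition channel_output (H : 'M[R]_n) (p : 'cV[R]_n * 'cV[R]_n) : 'cV[R]_n :=
  H *m p.1 + p.2.

HB.instance Definition _ := isMeasurableFun.Build _ _ _ _ channel_input
  (measurable_fst : measurable_fun setT channel_input).

Let measurable_channel_output (H : 'M[R]_n) :
  measurable_fun setT (channel_output H).
Proof.
apply: measurable_fun_cV => i.
rewrite [X in measurable_fun _ X](_ : _ = fun p : 'cV[R]_n * 'cV[R]_n =>
  \sum_j H i j * p.1 j ord0 + p.2 i ord0); last first.
  by apply/funext => p; rewrite /channel_output !mxE.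
apply: measurable_funD.
  apply: measurable_sum => j; apply: measurable_funM => //.
  exact: (measurableT_comp (measurable_coord j) measurable_fst).
exact: (measurableT_comp (measurable_coord i) measurable_snd).
Qed.

HB.instance Definition _ (H : 'M[R]_n) := isMeasurableFun.Build _ _ _ _
  (channel_output H) (measurable_channel_output H).

(* I(X; H X + Z) for X distributed according to F. *)
Definition channel_information (H : 'M[R]_n) (F : probability 'cV[R]_n R) :
    \bar R :=
  mutual_information (F \x std_gaussian n)%E channel_input (channel_output H).

(* A supremum in \bar R; it is a maximum whenever it is attained, which is the case
   for compact X. *)
Definition capacity (X : set 'cV[R]_n) (H : 'M[R]_n) : \bar R :=
  ereal_sup [set channel_information H F |
    F in [set F : probability 'cV[R]_n R | F X = 1%E]].

Definition C_EPI (X : set 'cV[R]_n) (H : 'M[R]_n) : R :=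
  n%:R / 2 * log2 (1 + `|\det H| `^ (2 / n%:R) * fine (vol n X) `^ (2 / n%:R)
                       / (2 * pi * expR 1)).

(* The norm `|x| of the library on 'cV[R]_n is the sup norm. *)
Definition euclidean_norm (x : 'cV[R]_n) : R :=
  Num.sqrt (\sum_(i < n) x i ord0 ^+ 2).

Definition euclidean_ball (r : R) : set 'cV[R]_n :=
  [set x | euclidean_norm x <= r].

(* The infimum is attained as soon as S is bounded. *)
Definition r_max (S : set 'cV[R]_n) : R :=
  inf [set r | 0 <= r /\ S `<=` euclidean_ball r].

Definition rho (X : set 'cV[R]_n) (H : 'M[R]_n) : R :=
  let HX := [set H *m x | x in X] in
  fine (vol n (euclidean_ball (r_max HX))) / fine (vol n HX).

End channel.

(* Main.v *)
(* For every positive q with total mass at most 1, I(X; HX + Z) is at most the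
   expectation of log (phi(Z) / q(HX + Z)), where phi is the density of Z.  Take
   q(y) proportional to exp (- (s |y|)^4).  With r = r_max(HX), only the bound
     E |HX + Z|^4 = E [(|HX|^2 + n)^2 + 4 |HX|^2 + 2n] <= (r^2 + n + 2)^2
   is needed to evaluate the expectation.  Choosing s^4 = n / (4 (r^2 + n + 2)^2)
   and bounding Gamma(n/4 + 1), which comes from the normalising constant of q, by
   sqrt (pi n) (n / 4e)^(n/4) gives, w_n being the volume of the unit ball,
     C <= log w_n + (1/2) log (pi n) + (n/2) log ((r^2 + n + 2) / (2 pi e)).
   Since w_n <= (2 pi e / (n + 2))^(n/2) and rho = w_n r^n / Vol(HX) >= 1, the right
   hand side is at most C_EPI + (1/2) log (pi n) + log rho. *)

Require Import Defs.
From HB Require Import structures.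
From mathcomp Require Import all_boot all_order all_algebra.
From mathcomp Require Import all_classical all_reals all_analysis.
From mathcomp Require Import measurable_realfun.
From mathcomp Require Import zify ring lra.
Import Order.TTheory GRing.Theory Num.Theory.
Import numFieldNormedType.Exports.
Local Open Scope classical_set_scope.
Local Open Scope ring_scope.

Set Implicit Arguments.
Unset Strict Implicit.
Unset Printing Implicit Defensive.

(** Why a quartic exponent: a Gaussian q needs only the second moment of the output and gives C <=
    (n/2) log (1 + r^2 / n). For large r this just misses the claim: it puts Gamma(n/2 + 1) = sqrt
    (pi n) (n / 2e)^(n/2) e^(t / 6n), with 0 < t < 1, where the claim allows only sqrt (pi n) (n /
    2e)^(n/2). The steeper exp (- (s |y|)^4) is closer to the uniform density on a ball. Its
    constant Gamma(n/4 + 1) is asymptotic to sqrt (pi n / 2) (n / 4e)^(n/4), and the spare factor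
    sqrt 2 pays for the error in Stirling's formula. The price is r^2 + n + 2 in place of the r^2 +
    n of the second moment. It is affordable because the volume of the unit ball satisfies w_n^(2/n)
    (n + 2) <= 2 pi e, which improves the same bound with n. *)

Lemma integral_probability_cst d (T : measurableType d) (R : realType)
    (P : probability T R) (a : \bar R) : (\int[P]__ a = a)%E.
Proof.
by rewrite integral_cst// -[RHS]mule1; congr (_ * _)%E; exact: probability_setT.
Qed.

(** * Densities, and affine changes of variable on the line *)

Section density.
Local Open Scope ereal_scope.
Context d (T : measurableType d) (R : realType).
Variables (nu : {finite_measure set T -> \bar R}).
Variables (mu : {sigma_finite_measure set T -> \bar R}) (h : T -> \bar R).
Hypothesis mh : measurable_fun setT h.
Hypothesis nuE : forall A, measurable A -> nu A = \int[mu]_(x in A) h x.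

Lemma density_dominates : nu `<< mu.
Proof.
apply/null_content_dominatesP => A mA muA0; rewrite nuE//.
by apply: null_set_integral => //; exact: measurable_funTS.
Qed.

Lemma Radon_Nikodym_density :
  ae_eq mu setT (Radon_Nikodym (charge_of_finite_measure nu) mu) h.
Proof.
have dom := density_dominates.
apply: integral_ae_eq => //; first exact: Radon_Nikodym_integrable.
by move=> E _ mE; rewrite -Radon_Nikodym_integral// -nuE.
Qed.

Lemma ge0_integral_density (f : T -> \bar R) : measurable_fun setT f ->
  (forall x, 0 <= f x) -> \int[nu]_x f x = \int[mu]_x (f x * h x).
Proof.
move=> mf f0; have dom := density_dominates.
rewrite -(Radon_Nikodym_SigmaFinite.change_of_variables dom)//.
apply: ae_eq_integral => //.
- apply: emeasurable_funM => //.
  exact: measurable_int (Radon_Nikodym_SigmaFinite.f_integrable dom).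
- exact: emeasurable_funM.
apply: ae_eqe_mul2l; apply: integral_ae_eq => //.
  exact: Radon_Nikodym_SigmaFinite.f_integrable.
by move=> E _ mE; rewrite -Radon_Nikodym_SigmaFinite.f_integral// -nuE.
Qed.

End density.

Section affine_change.
Local Open Scope ereal_scope.
Context {R : realType}.
Notation mu := (@lebesgue_measure R).

Lemma measurable_affine (a b : R) :
  measurable_fun [set: measurableTypeR R]
    ((fun x => a * x + b)%R : measurableTypeR R -> measurableTypeR R).
Proof. by apply: measurable_funD => //; exact: measurable_funM. Qed.

(** The image of Lebesgue measure under the affine map, scaled by |a|, agrees with Lebesgue measure
    on half-open intervals, which determines it. For a < 0 the preimage is half-open on the other
    side, with the same length. *)
Lemma ge0_integral_affine (a b : R) (f : R -> \bar R) : a != 0%R ->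
  measurable_fun setT f -> (forall x, 0 <= f x) ->
  `|a|%:E * \int[mu]_x f (a * x + b)%R = \int[mu]_x f x.
Proof.
move=> a0 mf f0.
have a0' : (0 < `|a|)%R by rewrite normr_gt0.
pose g : measurableTypeR R -> measurableTypeR R := fun x => (a * x + b)%R.
have mg : measurable_fun setT g := measurable_affine a b.
pose nu : {measure set (measurableTypeR R) -> \bar R} := pushforward mu g.
pose m := mscale (NngNum (ltW a0')) (nu mg).
have -> : \int[mu]_x f x = \int[m]_x f x.
  apply: eq_measure_integral => A mA _.
  apply: (@lebesgue_measure_unique R m _ A mA) => _ [[c e]] _ <-.
  rewrite /m/= /mscale/= /pushforward/=.
  have [alt|agt] := ltP a 0%R.
    rewrite (_ : g @^-1` _ = `[((e - b) / a)%R, ((c - b) / a)%R[%classic); last first.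
      apply/seteqP; split => x /=; rewrite !in_itv/= /g.
        by rewrite ler_ndivrMr// ltr_ndivlMr// (mulrC x) lerBrDr ltrBlDr andbC.
      by rewrite ler_ndivrMr// ltr_ndivlMr// (mulrC x) lerBrDr ltrBlDr andbC.
    rewrite !lebesgue_measure_itv/= !lte_fin ltr_nM2r ?invr_lt0// ltrD2r.
    case: ifPn => _; last by rewrite mule0.
    by rewrite -!EFinD -EFinM -mulrBl opprB addrA subrK ltr0_norm// mulrCA mulNr mulfV// mulrN1 opprB.
  have {}agt : (0 < a)%R by rewrite lt0r a0.
  rewrite (_ : g @^-1` _ = `](((c - b) / a)%R), ((e - b) / a)%R]%classic); last first.
    apply/seteqP; split => x /=; rewrite !in_itv/= /g.
      by rewrite ler_pdivlMr// ltr_pdivrMr// (mulrC x) lerBrDr ltrBlDr.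
    by rewrite ler_pdivlMr// ltr_pdivrMr// (mulrC x) lerBrDr ltrBlDr.
  rewrite !lebesgue_measure_itv/= !lte_fin ltr_pM2r ?invr_gt0// ltrD2r.
  case: ifPn => _; last by rewrite mule0.
  by rewrite -!EFinD -EFinM -mulrBl opprB addrA subrK gtr0_norm// mulrCA mulfV// mulr1.
by rewrite ge0_integral_mscale//= ge0_integral_pushforward.

Qed.

End affine_change.

(** * Layer cake and integration by parts on the half-line *)

Section layer_cake.
Local Open Scope ereal_scope.
Context d (T : measurableType d) (R : realType).
Variable mu : {sigma_finite_measure set T -> \bar R}.
Notation leb := (@lebesgue_measure R).

(** Write G (s t) as the integral of g over u >= s t and exchange the integrals by Tonelli. Used
    with s the Euclidean norm (radial integrals), s = |t| (integration by parts) and s = sqrt |t|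
    (the Gaussian integral). *)
Lemma layer_cake_tail (s : T -> R) (h : T -> \bar R) (g G : R -> R) :
  measurable_fun setT s -> (forall t, 0 <= s t)%R ->
  measurable_fun setT h -> (forall t, 0 <= h t) ->
  measurable_fun setT g -> (forall u, 0 <= u -> 0 <= g u)%R ->
  (forall x, (0 <= x)%R -> \int[leb]_(u in `[x, +oo[) (g u)%:E = (G x)%:E) ->
  \int[mu]_t (h t * (G (s t))%:E) =
  \int[leb]_(u in `[0%R, +oo[) ((g u)%:E * \int[mu]_(t in [set t | (s t <= u)%R]) h t).
Proof.
move=> ms s0 mh h0 mg g0 Gg.
(* Tonelli needs a nonnegative integrand on the whole plane, while [g] is only known to be
   nonnegative on the half-line. *)
pose g' u := if (0 <= u)%R then g u else 0%R.
have mg' : measurable_fun setT g' by apply: measurable_fun_ifT => //; exact: measurable_fun_ler.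
have g'0 u : (0 <= g' u)%R by rewrite /g'; case: ifPn => // u0; exact: g0.
pose A : set (T * measurableTypeR R) := [set p | (s p.1 <= p.2)%R].
have mA : measurable A.
  rewrite -[A]setTI; apply: measurable_fun_le => //.
  exact: (measurableT_comp ms measurable_fst).
pose f p := h p.1 * ((g' p.2)%:E * (\1_A p)%:E).
have mf : measurable_fun setT f.
  apply: emeasurable_funM; first exact: (measurableT_comp mh measurable_fst).
  apply: emeasurable_funM; apply/measurable_EFinP.
    exact: (measurableT_comp mg' measurable_snd).
  exact: measurable_indic.
have f0 p : 0 <= f p by rewrite !mule_ge0// lee_fin.
have := @fubini_tonelli _ _ _ _ _ mu leb f mf f0.
rewrite /f/= => FT.
transitivity (\int[mu]_t \int[leb]_u (h t * ((g' u)%:E * (\1_A (t, u))%:E))).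
  apply: eq_integral => t _; rewrite ge0_integralZl//; last 2 first.
  - apply: emeasurable_funM; apply/measurable_EFinP => //.
    apply/measurable_funTS; exact: (measurableT_comp (measurable_indic mA) (measurable_pair1 t)).
  - by move=> u _; rewrite mule_ge0// lee_fin.
  rewrite -Gg//; congr (_ * _); rewrite [LHS]integral_mkcond; apply: eq_integral => u _.
  rewrite patchE mem_setE in_itv/= andbT indicE /A /g' -EFinM.
  have [su|su] := leP (s t) u; last by rewrite memNset ?mulr0//= => /(lt_le_trans su); rewrite ltxx.
  by rewrite (le_trans (s0 t) su) mem_set// mulr1.
rewrite FT [RHS]integral_mkcond; apply: eq_integral => u _.
under eq_integral do rewrite muleCA.
rewrite ge0_integralZl//; last 3 first.
- apply: emeasurable_funM; first exact: mh.
  apply/measurable_EFinP; exact: (measurableT_comp (measurable_indic mA) (measurable_pair2 u)).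
- by move=> t _; rewrite mule_ge0// lee_fin.
- by rewrite lee_fin.
rewrite patchE mem_setE in_itv/= andbT /g'; case: ifPn => u0; last by rewrite mul0e.
congr (_ * _); rewrite [RHS]integral_mkcond; apply: eq_integral => t _.
rewrite indicE patchE /A; have [su|su] := leP (s t) u.
  by rewrite !mem_set// mule1.
by rewrite !memNset ?mule0//= => /(lt_le_trans su); rewrite ltxx.
Qed.

End layer_cake.

Section half_line.
Context {R : realType}.
Notation leb := (@lebesgue_measure R).

Lemma integral_tail (G g : R -> R) :
  (forall x : R, is_derive x 1 G (- g x)) -> continuous g ->
  (forall u, 0 <= u -> 0 <= g u) -> G x @[x --> +oo] --> 0 ->
  forall x, 0 <= x -> (\int[leb]_(u in `[x, +oo[) (g u)%:E = (G x)%:E)%E.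
Proof.
move=> dG cg g0 G0 x x0.
have dNG (y : R) : is_derive y 1 (\- G) (g y).
  by rewrite -[g y]opprK; apply: is_deriveN.
rewrite (@ge0_continuous_FTC2y _ g (\- G) x 0)//=.
- by rewrite -EFinB opprK add0r.
- by move=> y xy; apply: g0; exact: le_trans xy.
- exact: continuous_subspaceT.
- by move: G0 => /cvgN; rewrite oppr0.
- apply: cvg_at_right_filter.
  have /derivable1_diffP dd : derivable (\- G) x 1 by case: (dNG x).
  exact: (differentiable_continuous dd).
- by move=> y _; rewrite derive1E; exact: derive_val.
Qed.

Lemma integral_exprn_le (m : nat) (u : R) : 0 <= u ->
  (\int[leb]_(t in `[0%R, u]) (m.+1%:R * t ^+ m)%:E = (u ^+ m.+1)%:E)%E.
Proof.
rewrite le_eqVlt => /predU1P[<-|u0].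
  by rewrite set_itv1 integral_set1 expr0n.
rewrite (@continuous_FTC2 _ _ (fun t => t ^+ m.+1))//.
- by rewrite expr0n/= sube0.
- apply: continuous_subspaceT => t; apply: cvgM; first exact: cvg_cst.
  exact: exprn_continuous.
- split.
  + by move=> x _; exact: exprn_derivable.
  + by apply: cvg_at_right_filter; exact: exprn_continuous.
  + by apply: cvg_at_left_filter; exact: exprn_continuous.
- by move=> x _; rewrite exp_derive1 mulr_natl scaler_nat ?mulr_natl.
Qed.

(** Layer cake for the weight (m + 1) t^m on the half-line, whose integral up to u is u^(m+1). The
    identity lives in the extended reals, so it transfers finiteness from one moment to the next. *)
Lemma integral_exprS_by_parts (G g : R -> R) m :
  (forall x : R, is_derive x 1 G (- g x)) -> continuous g ->
  (forall u, 0 <= u -> 0 <= g u) -> G x @[x --> +oo] --> 0 ->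
  (\int[leb]_(u in `[0%R, +oo[) (u ^+ m.+1 * g u)%:E =
   \int[leb]_(u in `[0%R, +oo[) (m.+1%:R * u ^+ m * G u)%:E)%E.
Proof.
move=> dG cg g0 G0.
have tl := integral_tail dG cg g0 G0.
have mg : measurable_fun setT g by exact: continuous_measurable_fun.
pose h (t : R) : \bar R := ((fun t => (m.+1%:R * t ^+ m)%:E) \_ `[0%R, +oo[) t.
have h0 t : (0 <= h t)%E.
  rewrite /h patchE; case: ifPn => //; rewrite mem_setE in_itv/= andbT => t0.
  by rewrite lee_fin mulr_ge0// exprn_ge0.
have mp : measurable_fun [set: R] (fun t : R => m.+1%:R * t ^+ m).
  by apply: measurable_funM => //; exact: measurable_funX.
have mh : measurable_fun setT h.
  apply: (iffLR (measurable_restrictT _ (measurable_itv `[0%R, +oo[))).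
  exact/measurable_funTS/measurable_EFinP.
(* The layer cake asks for a function that is nonnegative everywhere; |t| agrees with t where the
   weight [h] does not vanish. *)
have ms : measurable_fun [set: measurableTypeR R] (fun t : R => `|t|).
  exact: normr_measurable.
have := layer_cake_tail leb ms (fun t => normr_ge0 t) mh h0 mg g0 tl.
rewrite [RHS](_ : _ = \int[leb]_(u in `[0%R, +oo[) (u ^+ m.+1 * g u)%:E)%E; last first.
  apply: eq_integral => u; rewrite inE/= in_itv/= andbT => u0.
  rewrite EFinM muleC -(integral_exprn_le _ u0); congr (_ * _)%E.
  transitivity (\int[leb]_(t in `[(- u)%R, u%R]) h t)%E.
    congr integral; apply/seteqP; split => t /=; by rewrite in_itv/= ler_norml.
  rewrite [LHS]integral_mkcond [RHS]integral_mkcond; apply: eq_integral => t _.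
  rewrite /h !patchE !mem_setE !in_itv/= andbT.
  have [t0|t0] := leP 0 t; last by rewrite /= if_same.
  by rewrite (le_trans _ t0) ?oppr_le0.
move=> <-; rewrite [RHS]integral_mkcond; apply: eq_integral => t _.
rewrite /h !patchE; case: ifPn => [|_]; last by rewrite mul0e.
by rewrite mem_setE in_itv/= andbT => t0; rewrite ger0_norm// EFinM.
Qed.

End half_line.

(** Serves the Gaussian density (b = 1/2, k = 1) and the quartic tail (b = 1, k = 3). *)
Lemma is_derive_expRN_expr {R : realType} (c b x : R) (k : nat) :
  is_derive x 1 (fun z => c * expR (- (b * z ^+ k.+1)))
    (- (c * (b * (k.+1%:R * x ^+ k)) * expR (- (b * x ^+ k.+1)))).
Proof.
have H1 : is_derive x 1 (fun z : R => z ^+ k.+1) (k.+1%:R * x ^+ k).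
  apply: DeriveDef; first exact: exprn_derivable.
  by rewrite exp_derive [LHS]mulr1.
have H2 := is_deriveZ (- b) H1.
have H3 := is_derive1_comp (is_derive_expR (((- b) \*: (fun z : R => z ^+ k.+1)) x)) H2.
have H4 := is_deriveZ c H3.
rewrite (_ : (fun z => _) = c \*: (expR \o (- b) \*: (fun z : R => z ^+ k.+1))); last first.
  by apply/funext => z /=; rewrite -mulNr.
apply: (is_derive_eq H4).
rewrite /= /GRing.scale/= (_ : - b * x ^+ k.+1 = - (b * x ^+ k.+1)) ?mulNr//.
by ring.
Qed.

(** * Gaussian moments *)

Section gaussian_moments.
Context {R : realType}.
Notation leb := (@lebesgue_measure R).
Notation pdf := (normal_pdf (0 : R) 1).

Lemma normal_pdf01E (z : R) : pdf z = normal_peak 1 * expR (- (2^-1 * z ^+ 2)).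
Proof.
rewrite normal_pdfE ?oner_neq0// /normal_fun subr0 expr1n.
by congr (_ * expR _); rewrite mulNr mulrC -mulr_natl mulr1.
Qed.

Lemma is_derive_gauss (x : R) : is_derive x 1 pdf (- (x * pdf x)).
Proof.
rewrite (_ : pdf = fun z => normal_peak 1 * expR (- (2^-1 * z ^+ 2))); last first.
  by apply/funext => z; exact: normal_pdf01E.
apply: (is_derive_eq (is_derive_expRN_expr (normal_peak 1) 2^-1 x 1)).
by rewrite expr1; field.
Qed.

Lemma continuous_expr_pdf m : continuous (fun z : R => z ^+ m * pdf z).
Proof.
move=> z; apply: cvgM; first exact: exprn_continuous.
exact: continuous_normal_pdf (oner_neq0 _) z.
Qed.

Lemma cvg_normal_pdf : pdf x @[x --> +oo] --> 0.
Proof.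
rewrite (_ : pdf = fun z => normal_peak 1 * expR (- (2^-1 * z ^+ 2))); last first.
  by apply/funext => z; exact: normal_pdf01E.
rewrite -(mulr0 (normal_peak 1)); apply: cvgM; first exact: cvg_cst.
apply: (@cvg_comp _ _ _ (fun z => 2^-1 * z ^+ 2) (fun y => expR (- y)) _ (pinfty_nbhs R)).
  by apply: gt0_cvgMry; [rewrite invr_gt0|exact: cvgr_expr2].
exact: cvgr_expR.
Qed.

(** Integration by parts from phi' = - u phi. *)
Lemma integral_expr_pdfS m :
  (\int[leb]_(u in `[0%R, +oo[) (u ^+ m.+2 * pdf u)%:E =
   m.+1%:R%:E * \int[leb]_(u in `[0%R, +oo[) (u ^+ m * pdf u)%:E)%E.
Proof.
transitivity (\int[leb]_(u in `[0%R, +oo[) (u ^+ m.+1 * (u * pdf u))%:E)%E.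
  by apply: eq_integral => u _; rewrite mulrA -exprSr.
rewrite (@integral_exprS_by_parts _ pdf (fun u => u * pdf u) m is_derive_gauss); last 3 first.
- by have := @continuous_expr_pdf 1; under eq_fun do rewrite expr1.
- by move=> u u0; rewrite mulr_ge0// normal_pdf_ge0.
- exact: cvg_normal_pdf.
under eq_integral do rewrite -mulrA EFinM.
rewrite ge0_integralZl_EFin//.
- move=> u; rewrite /= in_itv/= andbT => u0.
  by rewrite lee_fin mulr_ge0 ?exprn_ge0// normal_pdf_ge0.
- apply/measurable_EFinP; apply: measurable_funM => //.
  by apply: measurable_funTS; exact: measurable_normal_pdf.
Qed.

Lemma integral_expr_pdf_even m : ~~ odd m ->
  (\int[leb]_u (u ^+ m * pdf u)%:E =
   2%:E * \int[leb]_(u in `[0%R, +oo[) (u ^+ m * pdf u)%:E)%E.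
Proof.
move=> evm; rewrite ge0_symfun_integralT.
- by rewrite set_itvcy.
- by move=> u; rewrite mulr_ge0 ?normal_pdf_ge0// exprn_even_ge0.
- exact: continuous_expr_pdf.
- by move=> u /=; rewrite !normal_pdf01E sqrrN exprNn -signr_odd (negbTE evm) mul1r.
Qed.

Lemma integral_expr2_pdf : (\int[leb]_u (u ^+ 2 * pdf u)%:E = 1)%E.
Proof.
rewrite integral_expr_pdf_even// integral_expr_pdfS mul1e.
rewrite -integral_expr_pdf_even//; under eq_integral do rewrite expr0 mul1r.
exact: integral_normal_pdf.
Qed.

Lemma integral_expr4_pdf : (\int[leb]_u (u ^+ 4 * pdf u)%:E = 3%:E)%E.
Proof.
rewrite integral_expr_pdf_even// integral_expr_pdfS muleCA.
by rewrite -integral_expr_pdf_even// integral_expr2_pdf mule1.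
Qed.

End gaussian_moments.

Section shifted_gaussian_moments.
Context {R : realType}.
Notation leb := (@lebesgue_measure R).
Notation pdf := (normal_pdf (0 : R) 1).
Local Open Scope ereal_scope.

Lemma ge0_integral_normal_prob (f : R -> \bar R) :
  measurable_fun setT f -> (forall x, 0 <= f x) ->
  \int[normal_prob 0 1]_x f x = \int[leb]_x (f x * (pdf x)%:E).
Proof.
move=> mf f0.
apply: (@ge0_integral_density _ _ _ (normal_prob 0 1) leb (fun x => (pdf x)%:E)) => //.
- by apply/measurable_EFinP; exact: measurable_normal_pdf.
Qed.

Lemma measurable_expr_pdf (f : R -> R) : measurable_fun setT f ->
  measurable_fun setT (fun z => (f z * pdf z)%:E).
Proof.
move=> mf; apply/measurable_EFinP; apply: measurable_funM => //.
exact: measurable_normal_pdf.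
Qed.

Lemma integral_pdf_reflect (f : R -> R) : measurable_fun setT f ->
  (forall x, 0 <= f x)%R ->
  \int[leb]_z (f z * pdf z)%:E = \int[leb]_z (f (- z) * pdf z)%:E.
Proof.
move=> mf f0.
rewrite -(@ge0_integral_affine _ (-1) 0 (fun z => (f z * pdf z)%:E)) ?oppr_eq0 ?oner_eq0//.
- rewrite normrN1 mul1e; apply: eq_integral => z _.
  by rewrite addr0 mulN1r !normal_pdf01E sqrrN.
- exact: measurable_expr_pdf.
- by move=> x; rewrite lee_fin mulr_ge0// normal_pdf_ge0.
Qed.

(** Adding the reflected integrand removes the odd powers of z. What remains is a sum of nonnegative
    terms, so additivity applies without any integrability argument. *)
Lemma integral_pdf_symmetrize (f : R -> R) : measurable_fun setT f ->
  (forall x, 0 <= f x)%R ->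
  2%:E * \int[leb]_z (f z * pdf z)%:E =
  \int[leb]_z ((f z + f (- z)) * pdf z)%:E.
Proof.
move=> mf f0.
have mf' : measurable_fun setT (fun z : R => f (- z)%R).
  by apply: measurableT_comp => //; exact: oppr_measurable.
have p0 (x : R) : (0 <= pdf x)%R by exact: normal_pdf_ge0.
under [RHS]eq_integral do rewrite mulrDl EFinD.
rewrite ge0_integralD//; first last.
- exact: measurable_expr_pdf.
- by move=> x _; rewrite lee_fin mulr_ge0.
- exact: measurable_expr_pdf.
- by move=> x _; rewrite lee_fin mulr_ge0.
by rewrite -integral_pdf_reflect// mule_natl mule2n.
Qed.

Lemma mul2e_inj (A : \bar R) (c : R) : 2%:E * A = (2 * c)%:E -> A = c%:E.
Proof.
case: A => [r| |]; last 2 first.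
- by rewrite gt0_muley// lte_fin.
- by rewrite gt0_muleNy// lte_fin.
by rewrite -EFinM => -[/mulfI ->].
Qed.

Lemma integral_pdf_polynomial (a b c : R) : (0 <= a)%R -> (0 <= b)%R -> (0 <= c)%R ->
  \int[leb]_z ((a + b * z ^+ 2 + c * z ^+ 4) * pdf z)%:E = (a + b + 3 * c)%:E.
Proof.
move=> a0 b0 c0; have p0 (x : R) : (0 <= pdf x)%R by exact: normal_pdf_ge0.
have e0 m (x : R) : ~~ odd m -> (0 <= x ^+ m)%R by move=> ?; rewrite exprn_even_ge0.
have X0 m (x : R) : ~~ odd m -> 0 <= (x ^+ m * pdf x)%:E.
  by move=> om; rewrite lee_fin mulr_ge0// e0.
have mX m : measurable_fun [set: R] (fun z => (z ^+ m * pdf z)%:E).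
  by apply: measurable_expr_pdf; exact: measurable_funX.
transitivity (\int[leb]_z (a%:E * (pdf z)%:E + b%:E * (z ^+ 2 * pdf z)%:E +
    c%:E * (z ^+ 4 * pdf z)%:E)).
  by apply: eq_integral => z _; rewrite -!EFinM -!EFinD !mulrDl !mulrA.
have mp : measurable_fun [set: R] (fun z => (pdf z)%:E).
  by apply/measurable_EFinP; exact: measurable_normal_pdf.
rewrite ge0_integralD//; last 4 first.
- move=> x _; apply: adde_ge0; (apply: mule_ge0; first by rewrite lee_fin).
    by rewrite lee_fin.
  exact: X0.
- by apply: emeasurable_funD; apply: measurable_funeM; [exact: mp|exact: mX].
- move=> x _; apply: mule_ge0; [by rewrite lee_fin|exact: X0].
- by apply: measurable_funeM; first [exact: mp|exact: mX].
rewrite ge0_integralD//; last 4 first.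
- by move=> x _; rewrite mule_ge0// lee_fin.
- by apply: measurable_funeM; first [exact: mp|exact: mX].
- move=> x _; apply: mule_ge0; [by rewrite lee_fin|exact: X0].
- by apply: measurable_funeM; first [exact: mp|exact: mX].
have ZE (k : R) (f : R -> \bar R) : (0 <= k)%R -> measurable_fun setT f ->
    (forall z, 0 <= f z) -> \int[leb]_z (k%:E * f z) = k%:E * \int[leb]_z f z.
  by move=> k0 mf f0; rewrite ge0_integralZl_EFin.
rewrite (ZE a (fun z => (pdf z)%:E))// (ZE b (fun z => (z ^+ 2 * pdf z)%:E))//; last first.
  by move=> z; exact: X0.
rewrite (ZE c (fun z => (z ^+ 4 * pdf z)%:E))//; last by move=> z; exact: X0.
by rewrite integral_expr2_pdf integral_expr4_pdf integral_normal_pdf !mule1 -EFinM -!EFinD mulrC.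
Qed.

Lemma integral_pdf_shift2 (x : R) :
  \int[leb]_z ((x + z) ^+ 2 * pdf z)%:E = (x ^+ 2 + 1)%:E.
Proof.
apply: mul2e_inj; rewrite integral_pdf_symmetrize//; last 2 first.
- by apply: measurable_funX; exact: measurable_funD.
- by move=> z; rewrite sqr_ge0.
transitivity (\int[leb]_z ((2 * x ^+ 2 + 2 * z ^+ 2 + 0 * z ^+ 4) * pdf z)%:E).
  by apply: eq_integral => z _; congr (_ * _)%:E; ring.
rewrite integral_pdf_polynomial//; first by congr EFin; ring.
by apply: mulr_ge0; rewrite ?sqr_ge0.
Qed.

Lemma integral_pdf_shift4 (x : R) :
  \int[leb]_z ((x + z) ^+ 4 * pdf z)%:E = (x ^+ 4 + 6 * x ^+ 2 + 3)%:E.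
Proof.
apply: mul2e_inj; rewrite integral_pdf_symmetrize//; last 2 first.
- by apply: measurable_funX; exact: measurable_funD.
- by move=> z; rewrite exprn_even_ge0.
transitivity (\int[leb]_z ((2 * x ^+ 4 + 12 * x ^+ 2 * z ^+ 2 + 2 * z ^+ 4) * pdf z)%:E).
  by apply: eq_integral => z _; congr (_ * _)%:E; ring.
rewrite integral_pdf_polynomial//; first by congr EFin; ring.
  by apply: mulr_ge0; rewrite ?exprn_even_ge0.
by apply: mulr_ge0; rewrite ?sqr_ge0.
Qed.

Lemma normal_prob_shift2 (x : R) :
  \int[normal_prob 0 1]_z ((x + z) ^+ 2)%:E = (x ^+ 2 + 1)%:E.
Proof.
rewrite ge0_integral_normal_prob -?integral_pdf_shift2//.
- by apply/measurable_EFinP; apply: measurable_funX; exact: measurable_funD.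
- by move=> z; rewrite lee_fin sqr_ge0.
Qed.

Lemma normal_prob_shift4 (x : R) :
  \int[normal_prob 0 1]_z ((x + z) ^+ 4)%:E = (x ^+ 4 + 6 * x ^+ 2 + 3)%:E.
Proof.
rewrite ge0_integral_normal_prob -?integral_pdf_shift4//.
- by apply/measurable_EFinP; apply: measurable_funX; exact: measurable_funD.
- by move=> z; rewrite lee_fin exprn_even_ge0.
Qed.

End shifted_gaussian_moments.

(** * Numerical estimates and moments of exp(-u^4) *)

Section numerics.
Context {R : realType}.

Lemma ln_exprn (n : nat) (x : R) : 0 < x -> ln (x ^+ n) = n%:R * ln x.
Proof. by move=> x0; rewrite lnXn// mulr_natl. Qed.

Lemma ln_normal_peak : ln (normal_peak 1) = - (ln (2 * pi) / 2) :> R.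
Proof.
have p2 : 0 < 2 * pi :> R by rewrite mulr_gt0// pi_gt0.
rewrite /normal_peak expr1n mul1r -[(pi *+ 2)]mulr_natl lnV ?posrE ?sqrtr_gt0//; congr (- _).
by rewrite -[in RHS](sqr_sqrtr (ltW p2)) ln_exprn ?sqrtr_gt0//; field.
Qed.

(** The difference vanishes at 0, and its derivative 1 - (1 - t) e^t is nonnegative because 1 - t <=
    e^(-t). *)
Lemma expR_le_cayley (z : R) : 0 <= z -> (2 - z) * expR z <= 2 + z.
Proof.
move=> z0; pose f (t : R) := 2 + t - (2 - t) * expR t.
pose f' (t : R) := 1 - (1 - t) * expR t.
have df (t : R) : is_derive t 1 f (f' t).
  have H := is_deriveB (is_deriveD (is_derive_cst (2 : R) t 1) (is_derive_id t 1))
    (is_deriveM (is_deriveB (is_derive_cst (2 : R) t 1) (is_derive_id t 1)) (is_derive_expR t)).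
  apply: (is_derive_eq H).
  rewrite /GRing.scale/= /f' !fctE/=; ring.
have cf : {within `[0, z], continuous f}.
  apply: continuous_subspaceT => t.
  have /derivable1_diffP dd : derivable f t 1 by case: (df t).
  exact: (differentiable_continuous dd).
have [c c0z] := @MVT_segment R f f' 0 z z0 (fun t _ => df t) cf.
rewrite subr0 /f expR0 addr0 subr0 mulr1 subrr subr0 => fz.
rewrite -subr_ge0 fz mulr_ge0// /f' subr_ge0.
rewrite -(@ler_pM2r _ (expR (- c))) ?expR_gt0// -mulrA -expRD subrr expR0 mulr1 mul1r.
by have := expR_ge1Dx (- c); rewrite addrC.
Qed.

(** For z = 2y / (2 + y) the quotient (2 + z) / (2 - z) is 1 + y. This second-order accuracy is what
    the induction for the Gamma bound consumes, without loss. *)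
Lemma ln1D_ge (y : R) : 0 <= y -> 2 * y / (2 + y) <= ln (1 + y).
Proof.
move=> y0; set z := 2 * y / (2 + y).
have yp : 0 < 2 + y by rewrite ltr_wpDr.
have z0 : 0 <= z by rewrite divr_ge0 ?mulr_ge0// ltW.
have z2 : 2 - z = 4 / (2 + y) by rewrite /z; field; rewrite gt_eqF.
rewrite -ler_expR lnK ?posrE ?ltr_wpDr//.
have := expR_le_cayley z0; rewrite z2.
have -> : 2 + z = (1 + y) * (4 / (2 + y)) by rewrite /z; field; rewrite gt_eqF.
by rewrite mulrC ler_pM2r// divr_gt0.
Qed.

Lemma sin_le (x : R) : 0 <= x -> sin x <= x.
Proof.
move=> x0.
have cf : {within `[0, x], continuous (@sin R)}.
  by apply: continuous_subspaceT; exact: continuous_sin.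
have [c _] := @MVT_segment R sin cos 0 x x0 (fun t _ => is_derive_sin t) cf.
rewrite sin0 !subr0 => ->.
by rewrite ler_piMl// cos_le1.
Qed.

(** From sin (pi/4)^2 = 1/2 and sin x <= x. The number sqrt 8 then separates e from pi, and e <= pi
    is what the case n = 1 of the Gamma bound needs. *)
Lemma pi_sqr_ge8 : 8 <= pi ^+ 2 :> R.
Proof.
have := @cos_pihalf R.
have -> : pi / 2 = pi / 4 + pi / 4 :> R by field.
rewrite cosD -!expr2 cos2sin2 => /eqP.
rewrite -addrA -opprD subr_eq0 -mulr2n => /eqP s1.
have p4 : 0 <= pi / 4 :> R by rewrite divr_ge0// pi_ge0.
have s0 : 0 <= sin (pi / 4) :> R.
  by apply: sin_ge0_pi; rewrite p4/= ler_pdivrMr// ler_peMr ?pi_ge0// ler1n.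
have : sin (pi / 4) ^+ 2 <= (pi / 4) ^+ 2 :> R.
  by rewrite lerXn2r ?nnegrE//; exact: sin_le.
rewrite expr_div_n; nra.
Qed.

(** e^(-2) is the 32nd power of e^(-1/16) >= 15/16, and (15/16)^32 is just above 1/8. *)
Lemma expR1_sqr_le8 : expR 1 ^+ 2 <= 8 :> R.
Proof.
have H : 15 / 16 <= expR (- (16^-1)) :> R.
  by have := expR_ge1Dx (- (16^-1) : R); apply: le_trans; lra.
have : (15 / 16) ^+ 32 <= expR (- (16^-1)) ^+ 32 :> R by rewrite lerXn2r ?nnegrE ?expR_ge0//; lra.
rewrite -expRM_natl -expRM_natl mulr1.
have -> : 32%:R * - 16^-1 = - 2 :> R by field.
move=> h; rewrite -(@ler_pM2r _ (expR (- 2))) ?expR_gt0// -expRD subrr expR0.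
apply: le_trans (ler_wpM2l _ h) => //; lra.
Qed.

Lemma expR1_le_pi : expR 1 <= pi :> R.
Proof.
rewrite -(@ler_pXn2r _ 2)// ?nnegrE ?expR_ge0 ?pi_ge0//.
exact: le_trans expR1_sqr_le8 pi_sqr_ge8.
Qed.

Lemma ln_pi_ge1 : 1 <= ln pi :> R.
Proof. by rewrite -[1]expRK ler_ln ?posrE ?expR_gt0 ?pi_gt0// expR1_le_pi. Qed.

End numerics.

Section quartic_moments.
Context {R : realType}.
Notation leb := (@lebesgue_measure R).

(** Minus the derivative of exp (- u^4), hence a probability density on the half-line. *)
Definition quartic_density (u : R) : R := 4 * u ^+ 3 * expR (- u ^+ 4).

(* Equal to Gamma(n/4 + 1). *)
Definition quartic_moment (n : nat) : \bar R :=
  (\int[leb]_(u in `[0%R, +oo[) (u ^+ n * quartic_density u)%:E)%E.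

Notation tailf := (fun u : R => expR (- u ^+ 4)).

Lemma is_derive_tail (x : R) : is_derive x 1%R tailf (- quartic_density x).
Proof.
rewrite (_ : tailf = fun u => (1 * expR (- (1 * u ^+ 4)))%R); last first.
  by apply/funext => u; rewrite !mul1r.
apply: (is_derive_eq (is_derive_expRN_expr 1 1 x 3)).
by rewrite /quartic_density !mul1r.
Qed.

Lemma continuous_tail : continuous tailf.
Proof.
move=> x; have /derivable1_diffP dd : derivable tailf x 1 by case: (is_derive_tail x).
exact: (differentiable_continuous dd).
Qed.

Lemma continuous_quartic_density : continuous quartic_density.
Proof.
move=> x; apply: cvgM; last exact: continuous_tail.
by apply: cvgM; [exact: cvg_cst|exact: exprn_continuous].
Qed.

Lemma quartic_density_ge0 u : (0 <= u -> 0 <= quartic_density u)%R.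
Proof. by move=> u0; rewrite mulr_ge0 ?expR_ge0// mulr_ge0// exprn_ge0. Qed.

Lemma measurable_quartic_density : measurable_fun setT quartic_density.
Proof. by apply: continuous_measurable_fun; exact: continuous_quartic_density. Qed.

Lemma cvg_tail : tailf x @[x --> +oo%R] --> (0 : R)%R.
Proof.
apply: (@cvg_comp _ _ _ (fun z => z ^+ 4) (fun y => expR (- y)) _ (pinfty_nbhs R)).
  rewrite (_ : (fun z : R => _) = (fun z => z ^+ 2) \o (fun z => z ^+ 2)).
    apply: (@cvg_comp _ _ _ _ _ _ (pinfty_nbhs R)); exact: cvgr_expr2.
  by apply/funext => z /=; ring.
exact: cvgr_expR.
Qed.

Local Open Scope ereal_scope.

Lemma quartic_tail (x : R) : (0 <= x)%R ->
  \int[leb]_(u in `[x, +oo[) (quartic_density u)%:E = (expR (- x ^+ 4))%:E.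
Proof.
exact: integral_tail is_derive_tail continuous_quartic_density
  quartic_density_ge0 cvg_tail x.
Qed.

Lemma quartic_moment0 : quartic_moment 0 = 1.
Proof.
rewrite /quartic_moment; under eq_integral do rewrite expr0 mul1r.
by rewrite quartic_tail// expr0n/= oppr0 expR0.
Qed.

Lemma measurable_quartic n :
  measurable_fun setT (fun u : R => (u ^+ n * quartic_density u)%:E).
Proof.
apply/measurable_EFinP; apply: measurable_funM; first exact: measurable_funX.
exact: measurable_quartic_density.
Qed.

(** The functional equation Gamma(x + 1) = x Gamma(x) at x = n/4 + 1. *)
Lemma quartic_momentD4 n :
  quartic_moment (n + 4) = ((n + 4)%:R / 4)%:E * quartic_moment n.
Proof.
rewrite /quartic_moment addnS (@integral_exprS_by_parts _ tailf quartic_density _ is_derive_tail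
  continuous_quartic_density quartic_density_ge0 cvg_tail).
rewrite -ge0_integralZl_EFin//; last 2 first.
- move=> u /=; rewrite in_itv/= andbT => u0.
  by rewrite lee_fin mulr_ge0 ?exprn_ge0 ?quartic_density_ge0.
- by apply: measurable_funTS; exact: measurable_quartic.
apply: eq_integral => u _; rewrite -EFinM /quartic_density exprD; congr EFin.
by field.
Qed.

Lemma quartic_moment4 : quartic_moment 4 = 1.
Proof. by rewrite (quartic_momentD4 0) quartic_moment0 mule1 divff. Qed.

(** The constant a integrates to a because the zeroth moment is 1. Pointwise bounds of this form
    take the place of Jensen's inequality between moments. *)
Lemma quartic_moment_le k j (a b : R) : (0 <= a)%R -> (0 <= b)%R ->
  (forall u, 0 <= u -> u ^+ k <= a + b * u ^+ j)%R ->
  quartic_moment k <= a%:E + b%:E * quartic_moment j.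
Proof.
move=> a0 b0 kj; rewrite -(mule1 a%:E) -quartic_moment0 /quartic_moment.
have m0 i x : x \in `[0%R, +oo[ -> 0 <= (x ^+ i * quartic_density x)%:E.
  by rewrite in_itv/= andbT => x0; rewrite lee_fin mulr_ge0 ?exprn_ge0 ?quartic_density_ge0.
have mm i : measurable_fun (`[0%R, +oo[%classic : set (measurableTypeR R)) (fun u : R => (u ^+ i * quartic_density u)%:E).
  by apply: measurable_funTS; exact: measurable_quartic.
rewrite -!ge0_integralZl_EFin//; [|exact: m0|exact: m0].
rewrite -ge0_integralD//; last 4 first.
- by move=> x x0; apply: mule_ge0; [rewrite lee_fin|exact: m0].
- by apply: measurable_funeM; exact: mm.
- by move=> x x0; apply: mule_ge0; [rewrite lee_fin|exact: m0].
- by apply: measurable_funeM; exact: mm.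
apply: ge0_le_integral => //.
- exact: m0.
- by apply: emeasurable_funD; apply: measurable_funeM; exact: mm.
- move=> x; rewrite /= in_itv/= andbT => x0.
  rewrite -!EFinM -EFinD lee_fin (mulrA a) (mulrA b) -mulrDl.
  apply: ler_wpM2r; first exact: quartic_density_ge0.
  by rewrite expr0 mulr1; exact: kj.
Qed.

Lemma quartic_moment3 : quartic_moment 3 <= 1.
Proof.
have := @quartic_moment_le 3 4 (1 / 4) (3 / 4).
rewrite quartic_moment4 mule1 -EFinD (_ : 1 / 4 + 3 / 4 = 1)%R; last by field.
apply; [lra|lra|move=> u u0].
(* This product is 3 u^4 - 4 u^3 + 1. *)
have : (0 <= (u - 1) ^+ 2 * (3 * u ^+ 2 + 2 * u + 1))%R.
  by rewrite mulr_ge0 ?sqr_ge0//; nra.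
by rewrite -subr_ge0 => h; rewrite -subr_ge0; nra.
Qed.

(** Gamma(3/2), from the Gaussian integral: with s t = sqrt |t| one has exp (- t^2) = exp (- s^4),
    and the set s <= u is the interval [- u^2, u^2] of length 2 u^2. *)
Lemma quartic_moment2 : quartic_moment 2 = (Num.sqrt pi / 2)%:E.
Proof.
apply: (@mul2e_inj R); rewrite mulrCA mulfV// mulr1 -integralT_gauss.
have ms : measurable_fun [set: measurableTypeR R] (fun t : R => Num.sqrt `|t|).
  apply: measurableT_comp; last exact: normr_measurable.
  by apply: continuous_measurable_fun; exact: sqrt_continuous.
have LC := layer_cake_tail leb ms (fun t => sqrtr_ge0 `|t|)
  (@measurable_cst _ _ _ _ setT (1 : \bar R)) (fun=> lee01)
  measurable_quartic_density quartic_density_ge0 quartic_tail.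
transitivity (\int[leb]_t ((cst 1 t) * (expR (- Num.sqrt `|t| ^+ 4))%:E)); last first.
  apply: eq_integral => t _; rewrite mul1e /gauss_fun; congr (expR (- _))%:E.
  by rewrite (_ : 4 = 2 * 2)%N// exprM sqr_sqrtr// real_normK ?num_real.
rewrite LC /quartic_moment -ge0_integralZl_EFin//; last 2 first.
- move=> u /=; rewrite in_itv/= andbT => u0.
  by rewrite lee_fin mulr_ge0 ?exprn_ge0 ?quartic_density_ge0.
- by apply: measurable_funTS; exact: measurable_quartic.
apply: eq_integral => u; rewrite inE/= in_itv/= andbT => u0.
rewrite integral_cst//=; last first.
  rewrite -[X in measurable X]setTI; apply: measurable_fun_le => //.
rewrite mul1e (_ : [set _ | _] = `[(- u ^+ 2)%R, (u ^+ 2)%R]%classic); last first.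
  apply/seteqP; split => t /=; rewrite in_itv/= -ler_norml.
    by move=> tu; rewrite -(sqr_sqrtr (normr_ge0 t)) lerXn2r// nnegrE// sqrtr_ge0.
  by move=> tu; rewrite -(@ler_pXn2r _ 2)// ?nnegrE ?sqrtr_ge0// sqr_sqrtr.
rewrite lebesgue_measure_itv/= lte_fin.
case: ifPn => [_|].
  by rewrite -EFinB -!EFinM opprK; congr EFin; ring.
rewrite -leNgt => u20.
have -> : u = 0%R by apply/eqP; rewrite -sqrf_eq0 eq_le sqr_ge0 andbT; lra.
by rewrite expr0n/= !mul0r mule0 mule0.
Qed.

(** Integrate u <= l/2 + u^2 / (2l), choosing for l the square root of the second moment, which
    makes the two terms equal. *)
Lemma quartic_moment1 : quartic_moment 1 <= (Num.sqrt (Num.sqrt pi / 2))%:E.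
Proof.
set l := Num.sqrt _.
have l0 : (0 < l)%R by rewrite sqrtr_gt0 divr_gt0// sqrtr_gt0 pi_gt0.
have := @quartic_moment_le 1 2 (l / 2) (1 / (2 * l)).
have l2 : (l ^+ 2 = Num.sqrt pi / 2)%R by rewrite sqr_sqrtr// divr_ge0// sqrtr_ge0.
rewrite quartic_moment2 -l2 -EFinM -EFinD (_ : l / 2 + 1 / (2 * l) * l ^+ 2 = l)%R; last first.
  by field; rewrite gt_eqF.
apply; first by rewrite divr_ge0// ltW.
- by rewrite divr_ge0// mulr_ge0// ltW.
move=> u u0; rewrite expr1 -subr_ge0.
rewrite (_ : _ - u = (l - u) ^+ 2 / (2 * l))%R; last by field; rewrite gt_eqF.
by rewrite divr_ge0 ?sqr_ge0// mulr_ge0// ltW.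
Qed.

End quartic_moments.

(** * A Stirling bound for Gamma(n/4 + 1) *)

Section quartic_bound.
Context {R : realType}.

(* sqrt (pi n) (n / 4e)^(n/4): Stirling's formula for Gamma(n/4 + 1), with an extra
   factor sqrt 2. *)
Definition quartic_bound (n : nat) : R :=
  expR ((ln (pi * n%:R) + n%:R / 2 * (ln (n%:R / 4) - 1)) / 2).

Lemma ln_pi_nat (n : nat) : (0 < n)%N -> ln (pi * n%:R) = ln pi + ln n%:R :> R.
Proof. by move=> n0; rewrite lnM// posrE ?pi_gt0// ltr0n. Qed.

Lemma ln4E : ln 4 = 2 * ln 2 :> R.
Proof. by rewrite (_ : 4 = 2 ^+ 2)%R ?lnXn// ?mulr_natl//; ring. Qed.

Lemma ln4_ge1 : 1 <= ln 4 :> R.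
Proof.
rewrite -[leLHS]expRK ler_ln ?posrE ?expR_gt0//.
rewrite -(@ler_pXn2r _ 2)// ?nnegrE ?expR_ge0//.
by apply: le_trans (expR1_sqr_le8 (R := R)) _; rewrite expr2; lra.
Qed.

(** That is, 2^6 e <= 3^5, for which e <= 3 is enough; it serves the case n = 3. *)
Lemma ln3_ge : 1 + 6 * ln 2 <= 5 * ln 3 :> R.
Proof.
have -> : 6 * ln 2 = ln (2 ^+ 6) :> R by rewrite lnXn// mulr_natl.
have -> : 5 * ln 3 = ln (3 ^+ 5) :> R by rewrite lnXn// mulr_natl.
rewrite -[X in X + _]expRK -lnM ?posrE ?expR_gt0 ?exprn_gt0//.
rewrite ler_ln ?posrE ?mulr_gt0 ?expR_gt0 ?exprn_gt0//.
have : expR 1 <= 3 :> R.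
  rewrite -(@ler_pXn2r _ 2)// ?nnegrE ?expR_ge0//.
  by apply: le_trans (expR1_sqr_le8 (R := R)) _; rewrite expr2; lra.
lra.
Qed.

Lemma quartic_bound_ge1 (n : nat) :
  0 <= ln (pi * n%:R) + n%:R / 2 * (ln (n%:R / 4) - 1) :> R -> 1 <= quartic_bound n.
Proof. by move=> h; rewrite -expR0 ler_expR divr_ge0. Qed.

(** In fourth powers this reads pi / 4 <= pi^2 / (4e), that is, e <= pi. *)
Lemma quartic_bound1 : Num.sqrt (Num.sqrt pi / 2) <= quartic_bound 1.
Proof.
have p0 : 0 <= Num.sqrt pi / 2 :> R by rewrite divr_ge0 ?sqrtr_ge0.
rewrite -(@ler_pXn2r _ 4)// ?nnegrE ?sqrtr_ge0 ?expR_ge0//.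
rewrite (_ : 4 = 2 * 2)%N// exprM sqr_sqrtr// expr_div_n sqr_sqrtr ?pi_ge0//.
rewrite -expRM_natl mulr1 -[leLHS]lnK ?posrE ?divr_gt0 ?pi_gt0// ler_expR.
rewrite !ln_div ?posrE ?pi_gt0// ln1 (_ : 2 ^+ 2 = 4); last by ring.
have := ln_pi_ge1 (R := R); have := ln4_ge1; lra.
Qed.

(** After taking logarithms, everything cancels except (n + 2) ln ((n + 4) / n) >= 4, which is
    [ln1D_ge] at 4/n. *)
Lemma quartic_bound_step (n : nat) : (0 < n)%N ->
  (n + 4)%:R / 4 * quartic_bound n <= quartic_bound (n + 4).
Proof.
move=> n0; have nR : 0 < n%:R :> R by rewrite ltr0n.
have n4R : 0 < n%:R + 4 :> R by rewrite addr_gt0.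
rewrite /quartic_bound natrD -[X in X * _]lnK ?posrE ?divr_gt0// -expRD ler_expR.
rewrite !lnM ?posrE ?pi_gt0 ?invr_gt0// !lnV ?posrE//.
have H : 0 <= 4 / n%:R :> R by rewrite divr_ge0// ltW.
have := ln1D_ge H.
have -> : 1 + 4 / n%:R = (n%:R + 4) / n%:R :> R by field; rewrite gt_eqF.
rewrite ln_div ?posrE//.
have -> : 2 * (4 / n%:R) / (2 + 4 / n%:R) = 4 / (n%:R + 2) :> R.
  by field; rewrite !gt_eqF// addr_gt0.
rewrite ler_pdivrMr ?addr_gt0// => h.
rewrite -subr_ge0; set a := ln _ in h *; set b := ln n%:R in h *.
by nra.
Qed.

(** Moment and bound are compared by recursions of step 4, so 1, 2, 3 and 4 are base cases. In the
    last three the number 1 separates the moment from the bound. *)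
Lemma quartic_moment_bound (n : nat) : (0 < n)%N ->
  (quartic_moment (R := R) n <= (quartic_bound n)%:E)%E.
Proof.
have [k] := ubnP n; elim: k n => // k IH [//|[|[|[|[|n]]]]] nk _.
- by apply: le_trans quartic_moment1 _; rewrite lee_fin quartic_bound1.
- apply: (@le_trans _ _ 1%:E).
    have := @quartic_moment_le R 2 4 (1/2) (1/2).
    rewrite quartic_moment4 mule1 -EFinD (_ : 1 / 2 + 1 / 2 = 1)%R; last by field.
    by apply; [lra|lra|move=> u u0]; have := sqr_ge0 (u ^+ 2 - 1); nra.
  rewrite lee_fin quartic_bound_ge1// ln_pi_nat// ln_div ?posrE// ln4E.
  have := ln_pi_ge1 (R := R); lra.
- apply: (le_trans quartic_moment3).
  rewrite lee_fin quartic_bound_ge1// ln_pi_nat// ln_div ?posrE// ln4E.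
  have := ln_pi_ge1 (R := R); have := ln3_ge; lra.
- rewrite quartic_moment4 lee_fin quartic_bound_ge1// ln_pi_nat// divff// ln1.
  have := ln_pi_ge1 (R := R); have := ln4_ge1; lra.
- have -> : n.+1.+4 = (n.+1 + 4)%N by rewrite addn4.
  rewrite quartic_momentD4; apply: (@le_trans _ _ (((n.+1 + 4)%:R / 4)%:E * (quartic_bound n.+1)%:E)%E).
    by rewrite lee_wpmul2l ?lee_fin ?divr_ge0//; apply: IH => //; lia.
  by rewrite -EFinM lee_fin quartic_bound_step.
Qed.

End quartic_bound.

(** * Lebesgue measure under linear maps *)

Section vol_fubini.
Context {R : realType} {n : nat}.
Notation leb := (@lebesgue_measure R).
Implicit Types f : 'cV[R]_n.+1 -> \bar R.

Lemma cons_cV0 (r : R) (v : 'cV[R]_n) : cons_cV (r, v) ord0 ord0 = r.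
Proof. exact: (congr1 fst (cons_cVK (r, v))). Qed.

Lemma cons_cVS (r : R) (v : 'cV[R]_n) i : cons_cV (r, v) (lift ord0 i) ord0 = v i ord0.
Proof.
rewrite -[RHS]/((r, v).2 i ord0) -[in RHS](cons_cVK (r, v)) /uncons_cV [RHS]mxE.
by congr (fun_of_matrix _ _ _); exact/val_inj.
Qed.

Lemma integral_vol_cons f : measurable_fun setT f -> (forall x, 0 <= f x)%E ->
  (\int[vol n.+1]_x f x = \int[leb]_r \int[vol n]_v f (cons_cV (r, v)))%E.
Proof.
move=> mf f0.
have -> : (\int[vol n.+1]_x f x =
    \int[pushforward (leb \x vol n)%E cons_cV]_x f x)%E by [].
rewrite (ge0_integral_pushforward (measurable_cons_cV (R := R) (n := n)))//.
rewrite preimage_setT (@fubini_tonelli1 _ _ _ _ _ leb (vol n) (f \o cons_cV))//.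
  by apply: measurableT_comp => //; exact: measurable_cons_cV.
by move=> p; exact: f0.
Qed.

Lemma integral_vol_cons_swap f : measurable_fun setT f -> (forall x, 0 <= f x)%E ->
  (\int[vol n.+1]_x f x = \int[vol n]_v \int[leb]_r f (cons_cV (r, v)))%E.
Proof.
move=> mf f0; rewrite integral_vol_cons//.
rewrite (@fubini_tonelli _ _ _ _ _ leb (vol n) (f \o cons_cV))//.
  by apply: measurableT_comp => //; exact: measurable_cons_cV.
by move=> p; exact: f0.
Qed.

Lemma measurable_vol_cons f : measurable_fun setT f -> (forall x, 0 <= f x)%E ->
  measurable_fun setT (fun r => \int[vol n]_v f (cons_cV (r, v)))%E.
Proof.
move=> mf f0.
apply: (@measurable_fun_fubini_tonelli_F _ _ _ _ _ (vol n) (f \o cons_cV)) => //.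
  by apply: measurableT_comp => //; exact: measurable_cons_cV.
by move=> p; exact: f0.
Qed.

End vol_fubini.

Section vol_linear.
Context {R : realType}.
Notation leb := (@lebesgue_measure R).
Local Open Scope ereal_scope.

Lemma measurable_mulmx n (H : 'M[R]_n) :
  measurable_fun setT (fun x : 'cV[R]_n => H *m x)%R.
Proof.
apply: measurable_fun_cV => i; under eq_fun do rewrite mxE.
apply: measurable_sum => j; apply: measurable_funM => //.
exact: measurable_coord.
Qed.

Lemma measurable_addcV n (a : 'cV[R]_n) :
  measurable_fun setT (fun x : 'cV[R]_n => x + a)%R.
Proof.
apply: measurable_fun_cV => i; under eq_fun do rewrite mxE.
by apply: measurable_funD => //; exact: measurable_coord.
Qed.

Lemma measurable_cons_fix n (f : 'cV[R]_n.+1 -> \bar R) r :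
  measurable_fun setT f -> measurable_fun setT (fun v => f (cons_cV (r, v))).
Proof.
move=> mf; apply: (measurableT_comp mf).
by apply: (measurableT_comp measurable_cons_cV); exact: measurable_pair1.
Qed.

Lemma measurable_cons_fix2 n (f : 'cV[R]_n.+1 -> \bar R) (v : 'cV[R]_n) :
  measurable_fun setT f ->
  measurable_fun setT (fun r : measurableTypeR R => f (cons_cV (r, v))).
Proof.
move=> mf; apply: (measurableT_comp mf).
by apply: (measurableT_comp measurable_cons_cV); exact: measurable_pair2.
Qed.

Lemma integral_shift (b : R) (f : R -> \bar R) :
  measurable_fun setT f -> (forall x, 0 <= f x) ->
  \int[leb]_x f (x + b)%R = \int[leb]_x f x.
Proof.
move=> mf f0; rewrite -(@ge0_integral_affine R 1 b f) ?oner_eq0// normr1 mul1e.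
by apply: eq_integral => x _; rewrite mul1r.
Qed.

Lemma integral_vol_translate n (a : 'cV[R]_n) (f : 'cV[R]_n -> \bar R) :
  measurable_fun setT f -> (forall x, 0 <= f x) ->
  \int[vol n]_x f (x + a)%R = \int[vol n]_x f x.
Proof.
elim: n a f => [|n IH] a f mf f0.
  by apply: eq_integral => x _; congr f; rewrite !(flatmx0 _).
have mfa : measurable_fun setT (fun x : 'cV[R]_n.+1 => f (x + a)%R).
  exact: (measurableT_comp mf (measurable_addcV a)).
rewrite !integral_vol_cons//.
pose g r := \int[vol n]_v f (cons_cV (r, v)).
transitivity (\int[leb]_r g (r + a ord0 ord0)%R).
  apply: eq_integral => r _.
  rewrite /g -(IH (\col_i a (lift ord0 i) ord0)%R (fun v => f (cons_cV (r + a ord0 ord0, v)%R)))//; last first.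
    exact: measurable_cons_fix.
  apply: eq_integral => v _; congr f; apply/matrixP => i j.
  rewrite !ord1 [LHS]mxE; have [k ->|->] := unliftP ord0 i.
    by rewrite !cons_cVS !mxE.
  by rewrite !cons_cV0.
rewrite integral_shift//.
- exact: measurable_vol_cons.
- by move=> r; exact: integral_ge0.
Qed.

(** The change of variables formula as a predicate on matrices. Stated for functions it is stable
    under products, which leaves shears and block-diagonal matrices to check. *)
Definition vol_scales n (H : 'M[R]_n) := forall f : 'cV[R]_n -> \bar R,
  measurable_fun setT f -> (forall x, 0 <= f x) ->
  `|\det H|%:E * \int[vol n]_x f (H *m x)%R = \int[vol n]_x f x.

Lemma vol_scales_mul n (A B : 'M[R]_n) :
  vol_scales A -> vol_scales B -> vol_scales (A *m B).
Proof.
move=> vA vB f mf f0.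
have mfA : measurable_fun setT (fun x : 'cV[R]_n => f (A *m x)%R).
  exact: (measurableT_comp mf (measurable_mulmx A)).
have /= vBA := vB (fun x => f (A *m x)%R) mfA (fun x => f0 _).
rewrite -(vA f)// -vBA muleA -EFinM -normrM -det_mulmx.
by congr (_ * _); apply: eq_integral => x _; rewrite mulmxA.
Qed.

Lemma cons_cV_lshear n (c : 'cV[R]_n) (r : R) (v : 'cV[R]_n) :
  ((block_mx 1%:M 0 c 1%:M : 'M[R]_(1 + n)) *m cons_cV (r, v))%R = cons_cV (r, v + r *: c)%R.
Proof.
rewrite /cons_cV mul_block_col !mul1mx mul0mx addr0; congr col_mx.
rewrite addrC; congr (_ + _)%R; apply/matrixP => i j.
by rewrite !ord1 !mxE big_ord1 !mxE mulrC.
Qed.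

Lemma cons_cV_ushear n (b : 'rV[R]_n) (r : R) (v : 'cV[R]_n) :
  ((block_mx 1%:M b 0 1%:M : 'M[R]_(1 + n)) *m cons_cV (r, v))%R =
  cons_cV (r + (b *m v) ord0 ord0, v)%R.
Proof.
rewrite /cons_cV mul_block_col !mul1mx mul0mx add0r; congr col_mx.
by apply/matrixP => i j; rewrite !ord1 !mxE.
Qed.

(** The term [+ 0] gives the first coordinate the shape [a * x + b] of [ge0_integral_affine]. *)
Lemma cons_cV_diag n (a : R) (D : 'M[R]_n) (r : R) (v : 'cV[R]_n) :
  ((block_mx a%:M 0 0 D : 'M[R]_(1 + n)) *m cons_cV (r, v))%R =
  cons_cV (a * r + 0, D *m v)%R.
Proof.
rewrite /cons_cV mul_block_col !mul0mx addr0 add0r; congr col_mx.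
by rewrite mul_scalar_mx; apply/matrixP => i j; rewrite !mxE addr0.
Qed.

(** For a fixed first coordinate the shear translates the others, so the inner integral is
    unchanged. *)
Lemma vol_scales_lshear n (c : 'cV[R]_n) :
  vol_scales (block_mx 1%:M 0 c 1%:M : 'M[R]_(1 + n)).
Proof.
move=> f mf f0; rewrite det_lblock !det1 mulr1 normr1 mul1e.
have mfH := measurableT_comp mf (measurable_mulmx (block_mx 1%:M 0 c 1%:M : 'M[R]_(1 + n))).
rewrite !integral_vol_cons//; apply: eq_integral => r _.
under eq_integral do rewrite cons_cV_lshear.
rewrite (integral_vol_translate _ (f := fun v => f (cons_cV (r, v))))//.
exact: measurable_cons_fix.
Qed.

(** Here the first coordinate is translated by an amount depending on the others, so it has to be
    integrated first. *)
Lemma vol_scales_ushear n (b : 'rV[R]_n) :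
  vol_scales (block_mx 1%:M b 0 1%:M : 'M[R]_(1 + n)).
Proof.
move=> f mf f0; rewrite det_ublock !det1 mulr1 normr1 mul1e.
have mfH := measurableT_comp mf (measurable_mulmx (block_mx 1%:M b 0 1%:M : 'M[R]_(1 + n))).
rewrite !integral_vol_cons_swap//; apply: eq_integral => v _.
under eq_integral do rewrite cons_cV_ushear.
rewrite (integral_shift _ (f := fun r => f (cons_cV (r, v))))//.
exact: measurable_cons_fix2.
Qed.

Lemma vol_scales_diag n (a : R) (D : 'M[R]_n) : a != 0%R -> vol_scales D ->
  vol_scales (block_mx a%:M 0 0 D : 'M[R]_(1 + n)).
Proof.
move=> a0 vD f mf f0; rewrite det_ublock det_scalar1 normrM EFinM.
have mfH := measurableT_comp mf (measurable_mulmx (block_mx a%:M 0 0 D : 'M[R]_(1 + n))).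
rewrite !integral_vol_cons//.
pose g r := \int[vol n]_v f (cons_cV (r, v)).
have mg : measurable_fun setT g by exact: measurable_vol_cons.
have g0 r : 0 <= g r by exact: integral_ge0.
rewrite -(@ge0_integral_affine R a 0 g)// -muleA; congr (_ * _).
rewrite -ge0_integralZl_EFin//; last 2 first.
- by move=> r _; exact: integral_ge0.
- by apply: (measurable_vol_cons mfH) => x; exact: f0.
apply: eq_integral => r _; rewrite /g -(vD (fun v => f (cons_cV (a * r + 0, v)%R)))//; last exact: measurable_cons_fix.
by under eq_integral do rewrite /= cons_cV_diag.
Qed.

(* Schur complement with respect to the first coefficient, made nonzero by a shear. *)
Lemma vol_scales_unit n (H : 'M[R]_n) : H \in unitmx -> vol_scales H.
Proof.
elim: n H => [|n IH] H uH.
  move=> f mf f0; rewrite det_mx00 normr1 mul1e; apply: eq_integral => x _.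
  by rewrite !(flatmx0 (H *m x)) (flatmx0 x).
have piv (K : 'M[R]_(1 + n)) : K \in unitmx -> K ord0 ord0 != 0%R -> vol_scales K.
  move=> uK; set a := K ord0 ord0 => a0.
  pose B := ursubmx K; pose C := dlsubmx K; pose D := drsubmx K.
  have KE : K = block_mx a%:M B C D.
    rewrite -[LHS]submxK; congr block_mx; apply/matrixP => i j.
    by rewrite !ord1 !mxE eqxx mulr1n; congr (K _ _); exact/val_inj.
  have {}KE : K = (block_mx 1%:M 0 (a^-1 *: C) 1%:M : 'M[R]_(1 + n)) *m
      (block_mx a%:M 0 0 (D - a^-1 *: (C *m B))) *m
      (block_mx 1%:M (a^-1 *: B) 0 1%:M : 'M[R]_(1 + n)).
    rewrite KE !mulmx_block !mul1mx !mulmx1 !mul0mx !mulmx0 !addr0 !add0r.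
    rewrite !mul_mx_scalar !mul_scalar_mx !scalerA divff// !scale1r.
    by rewrite -scalemxAr addrC subrK.
  move: uK; rewrite KE 2!unitmx_mul => /andP[/andP[_ uD] _].
  apply: vol_scales_mul; last exact: vol_scales_ushear.
  apply: vol_scales_mul; first exact: vol_scales_lshear.
  apply: vol_scales_diag => //; apply: IH.
  by move: uD; rewrite !unitmxE det_ublock unitrM => /andP[].
have [a0|] := eqVneq (H ord0 ord0) 0%R; last exact: piv.
have [i Hi] : exists i, H i ord0 != 0%R.
  apply/existsP; rewrite -[X in is_true X]negbK negb_exists; apply/negP => /forallP H0.
  have : H *m delta_mx ord0 (ord0 : 'I_1) = 0%R.
    apply/matrixP => k j; rewrite !mxE big1// => l _; rewrite !mxE.
    have [->|l0] := eqVneq l ord0; last by rewrite mulr0.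
    by move: (H0 k); rewrite negbK => /eqP ->; rewrite mul0r.
  move/(congr1 (mulmx (invmx H))); rewrite mulKmx// mulmx0 => /matrixP/(_ ord0 ord0).
  by rewrite !mxE !eqxx => /eqP; rewrite oner_eq0.
have [j ij|i0] := unliftP ord0 i; last by move: Hi; rewrite i0 a0 eqxx.
(* [E] adds the row i, which carries a nonzero entry of the first column, to the first row. As H 0 0
   = 0, the new pivot is exactly H i 0. *)
pose e : 'rV[R]_n := delta_mx ord0 j.
pose E : 'M[R]_(1 + n) := block_mx 1%:M e 0 1%:M.
pose E' : 'M[R]_(1 + n) := block_mx 1%:M (- e) 0 1%:M.
have EE : E' *m E = 1%:M.
  rewrite mulmx_block !mul1mx !mulmx1 !mul0mx !mulmx0 !addr0 !add0r subrr.
  by rewrite -scalar_mx_block.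
have uE : E \in unitmx by rewrite unitmxE det_ublock !det1 mulr1 unitr1.
have -> : H = E' *m (E *m H) by rewrite mulmxA EE mul1mx.
apply: vol_scales_mul; first exact: vol_scales_ushear.
apply: piv; first by rewrite unitmx_mul uE.
have Ek k : E ord0 (lift ord0 k) = (k == j)%:R%R.
  transitivity (E (lshift n ord0) (rshift 1 k)).
    by congr (E _ _); exact/val_inj.
  by rewrite block_mxEur mxE eqxx.
rewrite mxE big_ord_recl a0 mulr0 add0r (bigD1 j)//= Ek eqxx mul1r -ij big1 ?addr0//.
by move=> k kj; rewrite Ek (negbTE kj) mul0r.
Qed.

Lemma vol_image n (H : 'M[R]_n) (A : set 'cV[R]_n) : H \in unitmx -> measurable A ->
  measurable [set H *m x | x in A]%R /\
  vol n [set H *m x | x in A]%R = `|\det H|%:E * vol n A.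
Proof.
move=> uH mA.
have AE : [set H *m x | x in A]%R = (fun x => invmx H *m x)%R @^-1` A.
  apply/seteqP; split => [_ [x Ax <-]|x Ax] /=; first by rewrite mulKmx.
  by exists (invmx H *m x)%R => //; rewrite mulKVmx.
have mHA : measurable [set H *m x | x in A]%R.
  by rewrite AE -[X in measurable X]setTI; apply: measurable_mulmx.
split => //.
have vi (B : set 'cV[R]_n) : measurable B -> vol n B = \int[vol n]_x (\1_B x)%:E.
  by move=> mB; rewrite integral_indic// setIT.
rewrite (vi _ mHA) (vi _ mA) -(vol_scales_unit uH)//.
- congr (_ * _); apply: eq_integral => x _; congr EFin.
  rewrite !indicE; congr (nat_of_bool _)%:R; apply/idP/idP => /set_mem h; apply/mem_set.
    case: h => y Ay /(congr1 (mulmx (invmx H))); rewrite !mulKmx// => <- //.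
  by exists x.
- by apply/measurable_EFinP; exact: measurable_indic.
Qed.

End vol_linear.

(** * The Euclidean norm and the Gaussian density *)

Section euclidean_norm.
Context {R : realType}.

Lemma euclidean_norm_sqr n (x : 'cV[R]_n) : euclidean_norm x ^+ 2 = \sum_i x i ord0 ^+ 2.
Proof. by rewrite sqr_sqrtr// sumr_ge0// => i _; rewrite sqr_ge0. Qed.

Lemma euclidean_norm_ge0 n (x : 'cV[R]_n) : 0 <= euclidean_norm x.
Proof. exact: sqrtr_ge0. Qed.

Lemma measurable_euclidean_norm n : measurable_fun setT (@euclidean_norm R n).
Proof.
rewrite /euclidean_norm; apply: measurableT_comp.
  by apply: continuous_measurable_fun; exact: sqrt_continuous.
apply: measurable_sum => i; apply: measurable_funX; exact: measurable_coord.
Qed.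

Lemma measurable_euclidean_ball n (r : R) : measurable (euclidean_ball (n := n) r).
Proof.
rewrite -[X in measurable X]setTI; apply: measurable_fun_le => //.
exact: measurable_euclidean_norm.
Qed.

Lemma euclidean_normZ n (s : R) (x : 'cV[R]_n) : 0 <= s ->
  euclidean_norm (s *: x) = s * euclidean_norm x.
Proof.
move=> s0; apply/eqP; rewrite -(@eqrXn2 _ 2)// ?mulr_ge0 ?euclidean_norm_ge0//.
rewrite exprMn !euclidean_norm_sqr mulr_sumr; apply/eqP/eq_bigr => i _.
by rewrite mxE exprMn.
Qed.

Lemma euclidean_norm_cons n (r : R) (v : 'cV[R]_n) :
  euclidean_norm (cons_cV (r, v)) ^+ 2 = r ^+ 2 + euclidean_norm v ^+ 2.
Proof.
rewrite !euclidean_norm_sqr big_ord_recl cons_cV0; congr (_ + _).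
by apply: eq_bigr => i _; rewrite cons_cVS.
Qed.

End euclidean_norm.

Section gaussian.
Context {R : realType}.
Notation leb := (@lebesgue_measure R).
Local Open Scope ereal_scope.

Lemma integral_gaussian_cons n (f : 'cV[R]_n.+1 -> \bar R) :
  measurable_fun setT f -> (forall x, 0 <= f x) ->
  \int[std_gaussian n.+1]_x f x =
  \int[normal_prob 0 1]_r \int[std_gaussian n]_v f (cons_cV (r, v)).
Proof.
move=> mf f0.
have -> : \int[std_gaussian n.+1]_x f x =
    \int[pushforward (normal_prob 0 1 \x std_gaussian n)%E cons_cV]_x f x by [].
rewrite (ge0_integral_pushforward (measurable_cons_cV (R := R) (n := n)))//.
rewrite preimage_setT (@fubini_tonelli1 _ _ _ _ _ (normal_prob 0 1) (std_gaussian n) (f \o cons_cV))//.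
  by apply: measurableT_comp => //; exact: measurable_cons_cV.
by move=> p; exact: f0.
Qed.

Definition gaussian_pdf n (x : 'cV[R]_n) : R :=
  (normal_peak 1 ^+ n * expR (- (2^-1 * euclidean_norm x ^+ 2)))%R.

Lemma gaussian_pdf_gt0 n (x : 'cV[R]_n) : (0 < gaussian_pdf x)%R.
Proof. by rewrite mulr_gt0 ?expR_gt0// exprn_gt0// normal_peak_gt0 ?oner_neq0. Qed.

Lemma measurable_gaussian_pdf n : measurable_fun setT (@gaussian_pdf n).
Proof.
apply: measurable_funM => //; apply: measurableT_comp => //.
apply: measurableT_comp => //; apply: measurable_funM => //.
by apply: measurable_funX; exact: measurable_euclidean_norm.
Qed.

Lemma gaussian_pdf_cons n (r : R) (v : 'cV[R]_n) :
  gaussian_pdf (cons_cV (r, v)) = (normal_pdf 0 1 r * gaussian_pdf v)%R.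
Proof.
rewrite /gaussian_pdf euclidean_norm_cons normal_pdf01E mulrDr opprD expRD exprS.
by rewrite !mulrA; congr (_ * _)%R; rewrite -!mulrA; congr (_ * _)%R; rewrite mulrC.
Qed.

Lemma integral_gaussianE n (f : 'cV[R]_n -> \bar R) :
  measurable_fun setT f -> (forall x, 0 <= f x) ->
  \int[std_gaussian n]_x f x = \int[vol n]_x (f x * (gaussian_pdf x)%:E).
Proof.
elim: n f => [|n IH] f mf f0.
  apply: eq_integral => x _; rewrite /gaussian_pdf euclidean_norm_sqr big_ord0.
  by rewrite mulr0 oppr0 expR0 expr0 mulr1 mule1.
have m1 : measurable_fun setT (fun x => f x * (gaussian_pdf x)%:E).
  apply: emeasurable_funM => //; apply/measurable_EFinP.
  exact: measurable_gaussian_pdf.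
have p0 m (x : 'cV[R]_m) : 0 <= (gaussian_pdf x)%:E by rewrite lee_fin ltW// gaussian_pdf_gt0.
have h0 x : 0 <= f x * (gaussian_pdf x)%:E by rewrite mule_ge0.
have mpdf : measurable_fun setT (fun v : 'cV[R]_n => (gaussian_pdf v)%:E).
  by apply/measurable_EFinP; exact: measurable_gaussian_pdf.
rewrite integral_gaussian_cons// integral_vol_cons//.
have mc r : measurable_fun setT (fun v => f (cons_cV (r, v))) := measurable_cons_fix r mf.
under eq_integral => r _ do rewrite IH//.
rewrite ge0_integral_normal_prob; last 2 first.
- apply: (@measurable_fun_fubini_tonelli_F _ _ _ _ _ (vol n)
    (fun p => f (cons_cV p) * (gaussian_pdf p.2)%:E)) => [|p].
    apply: emeasurable_funM; first by apply: measurableT_comp => //; exact: measurable_cons_cV.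
    exact: (measurableT_comp mpdf measurable_snd).
  exact: mule_ge0.
- by move=> r; apply: integral_ge0 => v _; rewrite mule_ge0.
apply: eq_integral => r _; rewrite muleC -ge0_integralZl//; last 3 first.
- exact: emeasurable_funM.
- by move=> v _; rewrite mule_ge0.
- by rewrite lee_fin normal_pdf_ge0.
by apply: eq_integral => v _; rewrite gaussian_pdf_cons muleCA -EFinM.
Qed.

Lemma integral_affine_comb d (T : measurableType d) (P : probability T R)
    (f g : T -> R) (a b m1 m2 : R) :
  measurable_fun setT f -> measurable_fun setT g ->
  (forall x, 0 <= f x)%R -> (forall x, 0 <= g x)%R -> (0 <= a)%R -> (0 <= b)%R ->
  \int[P]_x (f x)%:E = m1%:E -> \int[P]_x (g x)%:E = m2%:E ->
  \int[P]_x (a + b * f x + g x)%:E = (a + b * m1 + m2)%:E.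
Proof.
move=> mf mg f0 g0 a0 b0 m1E m2E.
under eq_integral do rewrite 2!EFinD EFinM.
have mf' : measurable_fun setT (fun x => b%:E * (f x)%:E).
  by apply: measurable_funeM; exact/measurable_EFinP.
rewrite ge0_integralD//; last 4 first.
- by move=> x _; apply: adde_ge0; rewrite ?mule_ge0 ?lee_fin.
- exact: emeasurable_funD.
- by move=> x _; rewrite lee_fin.
- exact/measurable_EFinP.
rewrite ge0_integralD//; last first.
  by move=> x _; rewrite mule_ge0 ?lee_fin.
rewrite integral_probability_cst ge0_integralZl_EFin//; last 2 first.
- by move=> x _; rewrite lee_fin.
- exact/measurable_EFinP.
by rewrite m1E m2E.
Qed.

Lemma integral_cst_add d (T : measurableType d) (P : probability T R)
    (g : T -> R) (a m : R) :
  measurable_fun setT g -> (forall x, 0 <= g x)%R -> (0 <= a)%R ->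
  \int[P]_x (g x)%:E = m%:E -> \int[P]_x (a + g x)%:E = (a + m)%:E.
Proof.
move=> mg g0 a0 mE.
have c0 : \int[P]__ (0 : R)%:E = (0 : R)%:E by rewrite integral0.
have /= := integral_affine_comb (@measurable_cst _ _ _ _ setT (0 : R)%R) mg
  (fun=> lexx _) g0 a0 (lexx 0%R) c0 mE.
by rewrite mulr0 addr0.
Qed.

Lemma cons_cVD n (r s : R) (v w : 'cV[R]_n) :
  (cons_cV (r, v) + cons_cV (s, w) = cons_cV (r + s, v + w))%R.
Proof.
apply/matrixP => i j; rewrite !ord1 [LHS]mxE.
have [k ->|->] := unliftP ord0 i; last by rewrite !cons_cV0.
by rewrite !cons_cVS [RHS]mxE.
Qed.

Lemma measurable_normX n m (x : 'cV[R]_n) :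
  measurable_fun setT (fun z : 'cV[R]_n => euclidean_norm (x + z) ^+ m)%R.
Proof.
apply: measurable_funX; apply: measurableT_comp; first exact: measurable_euclidean_norm.
rewrite [X in measurable_fun _ X](_ : _ = fun z => z + x)%R; first exact: measurable_addcV.
by apply/funext => z; rewrite /= addrC.
Qed.

Lemma uncons_cVK n : cancel (@uncons_cV R n) cons_cV.
Proof.
move=> x; apply/matrixP => i j; rewrite !ord1 /uncons_cV.
have [k ->|->] := unliftP ord0 i; last by rewrite cons_cV0.
by rewrite cons_cVS mxE; congr (x _ _); exact/val_inj.
Qed.

Lemma gaussian_shift2 n (x : 'cV[R]_n) :
  \int[std_gaussian n]_z (euclidean_norm (x + z) ^+ 2)%:E =
  (euclidean_norm x ^+ 2 + n%:R)%:E.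
Proof.
elim: n x => [|n IH] x.
  under eq_integral do rewrite euclidean_norm_sqr big_ord0.
  by rewrite integral0 euclidean_norm_sqr big_ord0 addr0.
rewrite -[x]uncons_cVK; case: (uncons_cV x) => r v.
rewrite integral_gaussian_cons; last 2 first.
- by apply/measurable_EFinP; exact: measurable_normX.
- by move=> z; rewrite lee_fin sqr_ge0.
have A0 : (0 <= euclidean_norm v ^+ 2 + n%:R)%R by rewrite addr_ge0 ?sqr_ge0.
transitivity (\int[normal_prob 0 1]_s
    ((euclidean_norm v ^+ 2 + n%:R) + (r + s) ^+ 2)%:E).
  apply: eq_integral => s _; rewrite addrC -(integral_cst_add _ _ _ (IH v)).
  - by apply: eq_integral => z _; rewrite cons_cVD euclidean_norm_cons.
  - exact: measurable_normX.
  - by move=> z; rewrite sqr_ge0.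
  - by rewrite sqr_ge0.
rewrite (integral_cst_add _ _ A0 (normal_prob_shift2 r)).
- by rewrite euclidean_norm_cons; congr EFin; rewrite -natr1; ring.
- by apply: measurable_funX; exact: measurable_funD.
- by move=> s; rewrite sqr_ge0.
Qed.

(** Splitting off a coordinate, the fourth power of the norm is (r + s)^4 + 2 (r + s)^2 |v + z|^2 +
    |v + z|^4, so the induction also calls for the second moment of the other coordinates. *)
Lemma gaussian_shift4 n (x : 'cV[R]_n) :
  \int[std_gaussian n]_z (euclidean_norm (x + z) ^+ 4)%:E =
  ((euclidean_norm x ^+ 2 + n%:R) ^+ 2 + 4 * euclidean_norm x ^+ 2 + 2 * n%:R)%:E.
Proof.
have sqsq (a : R) : (a ^+ 4 = (a ^+ 2) ^+ 2)%R by ring.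
elim: n x => [|n IH] x.
  under eq_integral do rewrite sqsq euclidean_norm_sqr big_ord0 expr0n/=.
  by rewrite integral0 euclidean_norm_sqr big_ord0; congr EFin; ring.
rewrite -[x]uncons_cVK; case: (uncons_cV x) => r v.
rewrite integral_gaussian_cons; last 2 first.
- by apply/measurable_EFinP; exact: measurable_normX.
- by move=> z; rewrite lee_fin exprn_even_ge0.
(* [A] and [M] are the second and fourth moments of the remaining n coordinates. *)
set A := (euclidean_norm v ^+ 2 + n%:R)%R.
set M := (A ^+ 2 + 4 * euclidean_norm v ^+ 2 + 2 * n%:R)%R.
have A0 : (0 <= A)%R by rewrite addr_ge0 ?sqr_ge0.
have M0 : (0 <= M)%R.
  apply: addr_ge0; last exact: mulr_ge0.
  by apply: addr_ge0; [exact: sqr_ge0|apply: mulr_ge0 => //; exact: sqr_ge0].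
transitivity (\int[normal_prob 0 1]_s
    (M + (2 * A) * (r + s) ^+ 2 + (r + s) ^+ 4)%:E).
  apply: eq_integral => s _.
  rewrite (_ : _ + _ + _ = (r + s) ^+ 4 + (2 * (r + s) ^+ 2) * A + M)%R; last by ring.
  rewrite -(@integral_affine_comb _ _ (std_gaussian n) _ _ _ _ _ _ _ _ _ _ _ _ (gaussian_shift2 v) (IH v)).
  - apply: eq_integral => z _; rewrite cons_cVD sqsq euclidean_norm_cons.
    by congr EFin; ring.
  - exact: measurable_normX.
  - exact: measurable_normX.
  - by move=> z; rewrite sqr_ge0.
  - by move=> z; rewrite exprn_even_ge0.
  - by rewrite exprn_even_ge0.
  - by rewrite mulr_ge0// sqr_ge0.
rewrite (@integral_affine_comb _ _ (normal_prob 0 1) (fun s => (r + s) ^+ 2)%R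
  (fun s => (r + s) ^+ 4)%R _ _ (r ^+ 2 + 1)%R (r ^+ 4 + 6 * r ^+ 2 + 3)%R).
- by rewrite euclidean_norm_cons /M /A; congr EFin; rewrite -natr1; ring.
- by apply: measurable_funX; exact: measurable_funD.
- by apply: measurable_funX; exact: measurable_funD.
- by move=> s; rewrite sqr_ge0.
- by move=> s; rewrite exprn_even_ge0.
- exact: M0.
- by rewrite mulr_ge0.
- exact: normal_prob_shift2.
- exact: normal_prob_shift4.
Qed.

End gaussian.

(** * Euclidean balls *)

Section ball.
Context {R : realType}.
Notation leb := (@lebesgue_measure R).
Local Open Scope ereal_scope.

Definition unit_ball_vol n : R := fine (vol n (euclidean_ball (n := n) (1 : R))).

Lemma scalar_unitmx n (s : R) : s != 0%R -> (s%:M : 'M[R]_n) \in unitmx.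
Proof. by move=> s0; rewrite unitmxE det_scalar unitrX// unitfE. Qed.

Lemma euclidean_ball_image n (r : R) : (0 < r)%R ->
  euclidean_ball r = [set (r%:M *m x)%R | x in euclidean_ball (n := n) 1%R].
Proof.
move=> r0; have r0' := ltW r0.
apply/seteqP; split => [x xr|_ [x x1 <-]]; rewrite /euclidean_ball/=; last first.
  by rewrite mul_scalar_mx euclidean_normZ// ler_piMr.
exists (r^-1 *: x)%R; last by rewrite mul_scalar_mx scalerA divff ?scale1r ?gt_eqF.
by rewrite /euclidean_ball/= euclidean_normZ ?invr_ge0// mulrC ler_pdivrMr// mul1r.
Qed.

(** The ball lies in the cube [-1, 1]^n. Finiteness guarantees that [fine] in [unit_ball_vol]
    returns the true volume. *)
Lemma vol_ball1_lty n : vol n (euclidean_ball (n := n) (1 : R)) < +oo.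
Proof.
pose A (i : 'I_n) : set R := `[(-1)%R, 1%R]%classic.
have mA i : measurable (A i) by exact: measurable_itv.
apply: (@le_lt_trans _ _ (vol n [set x : 'cV[R]_n | forall i, A i (x i ord0)])).
  apply: le_measure; rewrite ?inE.
  - exact: measurable_euclidean_ball.
  - exact: measurable_rect.
  move=> x; rewrite /euclidean_ball/= => x1 i; rewrite /A/= in_itv/= -ler_norml.
  apply: le_trans x1; rewrite -(sqrtr_sqr (x i ord0)) ler_wsqrtr//.
  by rewrite (bigD1 i)//= lerDl sumr_ge0// => j _; rewrite sqr_ge0.
rewrite vol_rect//; apply: (@le_lt_trans _ _ (\prod_(i < n) (2 : R)%:E)).
  rewrite le_eqVlt; apply/orP; left; apply/eqP; apply: eq_bigr => i _.
  rewrite /A lebesgue_measure_itv/= lte_fin ifT; last by lra.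
  by rewrite -EFinB; congr EFin; ring.
by rewrite prodEFin ltry.
Qed.

Lemma vol_ball (n : nat) (r : R) : (0 < r)%R ->
  vol n (euclidean_ball (n := n) r) = (unit_ball_vol n * r ^+ n)%:E.
Proof.
move=> r0; have r0' := ltW r0; rewrite euclidean_ball_image//.
have [_ ->] := vol_image (scalar_unitmx n (lt0r_neq0 r0)) (measurable_euclidean_ball (n := n) (1 : R)).
rewrite det_scalar ger0_norm ?exprn_ge0// mulrC EFinM /unit_ball_vol fineK//.
by rewrite ge0_fin_numE// vol_ball1_lty.
Qed.

(** Excludes r = 0 when HX has positive volume. In dimension 0 the ball is the whole space, of
    volume 1. *)
Lemma vol_ball0 (n : nat) : (0 < n)%N -> vol n (euclidean_ball (n := n) (0 : R)) = 0.
Proof.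
case: n => // n _.
rewrite (_ : euclidean_ball _ = [set x : 'cV[R]_n.+1 | forall i, [set 0%R] (x i ord0)]).
  by rewrite (vol_rect (A := fun=> [set 0%R]))// big_ord_recl lebesgue_measure_set1 mul0e.
apply/seteqP; split => x; rewrite /euclidean_ball /euclidean_norm/=; last first.
  by move=> x0; rewrite big1 ?sqrtr0// => i _; rewrite x0 expr0n.
rewrite le_eqVlt ltNge sqrtr_ge0 orbF sqrtr_eq0 => s0 i.
have : (x i ord0 ^+ 2 <= 0)%R.
  by apply: le_trans s0; rewrite (bigD1 i)//= lerDl sumr_ge0// => j _; rewrite sqr_ge0.
by move=> xi; apply/eqP; rewrite -sqrf_eq0 eq_le xi sqr_ge0.
Qed.

(** The layer cake formula does the work of polar coordinates: the set |y| <= u has volume w_n u^n.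
    The value g 0 = 0 settles u = 0, which [vol_ball] does not cover. *)
Lemma integral_radial n (g G : R -> R) :
  measurable_fun setT g -> (forall u, 0 <= u -> 0 <= g u)%R -> g 0%R = 0%R ->
  (forall x, (0 <= x)%R -> \int[leb]_(u in `[x, +oo[) (g u)%:E = (G x)%:E) ->
  \int[vol n]_y (G (euclidean_norm y))%:E =
  (unit_ball_vol n)%:E * \int[leb]_(u in `[0%R, +oo[) (u ^+ n * g u)%:E.
Proof.
move=> mg g0 g00 Gg.
have LC := layer_cake_tail (vol n) (measurable_euclidean_norm (n := n))
  (@euclidean_norm_ge0 R n) (@measurable_cst _ _ _ _ setT (1 : \bar R)) (fun=> lee01) mg g0 Gg.
transitivity (\int[vol n]_t (cst 1 t * (G (euclidean_norm t))%:E)).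
  by apply: eq_integral => y _; rewrite mul1e.
rewrite LC -ge0_integralZl_EFin//; last 3 first.
- move=> u /=; rewrite in_itv/= andbT => u0.
  by rewrite lee_fin mulr_ge0 ?exprn_ge0 ?g0.
- apply: measurable_funTS; apply/measurable_EFinP; apply: measurable_funM => //.
- by rewrite /unit_ball_vol fine_ge0.
apply: eq_integral => u; rewrite inE/= in_itv/= andbT => u0.
rewrite integral_cst//=; last exact: measurable_euclidean_ball.
rewrite mul1e -/(euclidean_ball u).
have [->|un0] := eqVneq u 0%R; first by rewrite g00 mulr0 mule0 mul0e.
by rewrite vol_ball ?lt0r ?un0// -!EFinM; congr EFin; ring.
Qed.

(** The map y -> s y has determinant s^n, and the radial integral of exp (- |y|^4) is w_n Gamma(n/4
    + 1). *)
Lemma integral_quartic_le n (s : R) : (0 < n)%N -> (0 < s)%R ->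
  (s ^+ n)%:E * \int[vol n]_y (expR (- (s * euclidean_norm y) ^+ 4))%:E <=
  (unit_ball_vol n * quartic_bound n)%:E.
Proof.
move=> n0 s0; have s0' := ltW s0.
have v0 : (0 <= unit_ball_vol n)%R by rewrite /unit_ball_vol fine_ge0.
have := @integral_radial n _ _ measurable_quartic_density quartic_density_ge0 _ quartic_tail.
rewrite -/(quartic_moment n) => H.
have mf : measurable_fun setT (fun y : 'cV[R]_n => (expR (- euclidean_norm y ^+ 4))%:E).
  apply/measurable_EFinP; apply: measurableT_comp => //; apply: measurableT_comp => //.
  by apply: measurable_funX; exact: measurable_euclidean_norm.
have f0 (y : 'cV[R]_n) : 0 <= (expR (- euclidean_norm y ^+ 4))%:E by rewrite lee_fin expR_ge0.
have := vol_scales_unit (scalar_unitmx n (lt0r_neq0 s0)) mf f0.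
rewrite det_scalar ger0_norm ?exprn_ge0// => sc.
under eq_integral do rewrite -euclidean_normZ// -mul_scalar_mx.
rewrite sc H ?EFinM ?lee_wpmul2l ?lee_fin ?quartic_moment_bound//.
by rewrite /quartic_density expr0n/= mulr0 mul0r.
Qed.

End ball.

Section ball_bound.
Context {R : realType}.
Notation leb := (@lebesgue_measure R).
Local Open Scope ereal_scope.

Lemma integral_itv_id (x r : R) : (x <= r)%R ->
  \int[leb]_(u in `[x, r]) u%:E = ((r ^+ 2 - x ^+ 2) / 2)%:E.
Proof.
rewrite le_eqVlt => /predU1P[->|xr].
  by rewrite set_itv1 integral_set1 subrr mul0r.
have dF (t : R) : is_derive t 1%R (2^-1 \*: (fun t : R => t ^+ 2))%R t.
  have H1 : is_derive t 1%R (fun z : R => z ^+ 2)%R (2 * t)%R.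
    apply: DeriveDef; first exact: exprn_derivable.
    by rewrite exp_derive [LHS]mulr1 /= expr1.
  have H2 := is_deriveZ 2^-1%R H1.
  by apply: (is_derive_eq H2); rewrite /GRing.scale/= mulrA mulVf// mul1r.
have cF (t : R) : {for t, continuous (2^-1 \*: (fun t : R => t ^+ 2))%R}.
  have /derivable1_diffP dd : derivable (2^-1 \*: (fun t : R => t ^+ 2))%R t 1 by case: (dF t).
  exact: (differentiable_continuous dd).
rewrite (@continuous_FTC2 _ idfun (2^-1 \*: (fun t : R => t ^+ 2))%R)//.
- by rewrite -EFinB /= /GRing.scale/=; congr EFin; ring.
- by apply: continuous_subspaceT => t; exact: cvg_id.
- split.
  + by move=> t _; case: (dF t).
  + by apply: cvg_at_right_filter; exact: cF.
  + by apply: cvg_at_left_filter; exact: cF.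
- by move=> t _; rewrite derive1E; case: (dF t).
Qed.

(* With t = (n - |y|^2) / 2, the inequality exp t >= 1 + t = (n + 2 - |y|^2) / 2 bounds
   the Gaussian density from below on the ball of radius sqrt (n + 2); integrate it
   there. *)
Lemma unit_ball_vol_le n :
  (unit_ball_vol (R := R) n * (normal_peak 1 ^+ n * expR (- (n%:R / 2)) * Num.sqrt (n%:R + 2) ^+ n)
   <= 1)%R.
Proof.
set r := Num.sqrt _.
have n2 : (0 <= n%:R + 2 :> R)%R by rewrite addr_ge0.
have r0 : (0 < r)%R by rewrite sqrtr_gt0 ltr_wpDl.
have r0' := ltW r0.
have r2 : (r ^+ 2 = n%:R + 2)%R by rewrite sqr_sqrtr.
(* [G] is the parabola (r^2 - x^2) / 2 cut off at r, where the lower bound of the exponential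
   changes sign; [g] is minus its derivative on the half-line. *)
pose g (u : R) : R := if (u <= r)%R then u else 0%R.
pose G (x : R) : R := if (x <= r)%R then ((r ^+ 2 - x ^+ 2) / 2)%R else 0%R.
have mg : measurable_fun setT g.
  by apply: measurable_fun_ifT => //; exact: measurable_fun_ler.
have tail x : (0 <= x)%R -> \int[leb]_(u in `[x, +oo[) (g u)%:E = (G x)%:E.
  move=> x0; rewrite /G; case: ifPn => [xr|].
    rewrite -integral_itv_id// integral_mkcond [RHS]integral_mkcond.
    apply: eq_integral => u _; rewrite !patchE !mem_setE !in_itv/= andbT /g.
    by case: (x <= u)%R => //=; case: ifP.
  rewrite -ltNge => rx; apply: integral0_eq => u; rewrite /= in_itv/= andbT => xu.
  by rewrite /g leNgt (lt_le_trans rx xu).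
have g00 : g 0%R = 0%R by rewrite /g; case: ifP.
have g0 u : (0 <= u -> 0 <= g u)%R by rewrite /g; case: ifP.
have := @integral_radial R n g G mg g0 g00 tail.
(* The integral is r^(n+2) / (n + 2), and r^2 = n + 2. *)
have -> : \int[leb]_(u in `[0%R, +oo[) (u ^+ n * g u)%:E = (r ^+ n)%:E.
  have := integral_exprn_le n.+1 r0'.
  under eq_integral do rewrite EFinM.
  rewrite ge0_integralZl_EFin//; last 2 first.
  - by move=> u; rewrite /= in_itv/= => /andP[u0 _]; rewrite lee_fin exprn_ge0.
  - by apply: measurable_funTS; apply/measurable_EFinP; exact: measurable_funX.
  have -> : \int[leb]_(u in `[0%R, +oo[) (u ^+ n * g u)%:E =
            \int[leb]_(u in `[0%R, r]) (u ^+ n.+1)%:E.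
    rewrite integral_mkcond [RHS]integral_mkcond.
    apply: eq_integral => u _; rewrite !patchE !mem_setE !in_itv/= andbT /g.
    case: (0 <= u)%R => //=; case: ifP => _; first by rewrite exprSr.
    by rewrite mulr0.
  move=> H; have : (n.+2%:R^-1)%:E * (n.+2%:R%:E * \int[leb]_(u in `[0%R, r]) (u ^+ n.+1)%:E)
      = (n.+2%:R^-1)%:E * (r ^+ n.+2)%:E by rewrite H.
  rewrite muleA -EFinM mulVf// mul1e => ->; rewrite -EFinM; congr EFin.
  rewrite -addn2 exprD r2 natrD; field.
  by rewrite gt_eqF// ltr_wpDl.
move=> H.
have G0 x : (0 <= x -> 0 <= G x)%R.
  move=> x0; rewrite /G; case: ifPn => // xr.
  by rewrite divr_ge0// subr_ge0 lerXn2r// nnegrE.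
have mG : measurable_fun setT G.
  apply: measurable_fun_ifT => //; first exact: measurable_fun_ler.
  by apply: measurable_funM => //; apply: measurable_funB => //; exact: measurable_funX.
have mGn : measurable_fun setT (fun y : 'cV[R]_n => (G (euclidean_norm y))%:E).
  apply/measurable_EFinP; apply: measurableT_comp => //.
  exact: measurable_euclidean_norm.
have p0 : (0 <= normal_peak 1 ^+ n * expR (- (n%:R / 2)) :> R)%R.
  by rewrite mulr_ge0 ?expR_ge0// exprn_ge0// normal_peak_ge0.
rewrite -lee_fin.
apply: (@le_trans _ _ ((normal_peak 1 ^+ n * expR (- (n%:R / 2)))%:E *
    \int[vol n]_y (G (euclidean_norm y))%:E)).
  by rewrite H -!EFinM lee_fin le_eqVlt; apply/orP; left; apply/eqP; ring.
have := @integral_gaussianE R n (cst 1) (@measurable_cst _ _ _ _ setT (1 : \bar R)) (fun=> lee01).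
rewrite integral_cst// mul1e => T1.
have <- : std_gaussian n [set: 'cV[R]_n] = 1 by exact: probability_setT.
rewrite T1 -ge0_integralZl_EFin//; last first.
  by move=> y _; rewrite lee_fin G0// euclidean_norm_ge0.
apply: ge0_le_integral => //.
- by move=> y _; rewrite mule_ge0// lee_fin// G0// euclidean_norm_ge0.
- exact: measurable_funeM.
- by apply: emeasurable_funM => //; apply/measurable_EFinP; exact: measurable_gaussian_pdf.
move=> y _; rewrite mul1e -EFinM lee_fin /gaussian_pdf -mulrA.
apply: ler_wpM2l; first by rewrite exprn_ge0// normal_peak_ge0.
rewrite /G; case: ifPn => _; last by rewrite mulr0 expR_ge0.
set s := (euclidean_norm y ^+ 2)%R; rewrite r2.
have -> : (- (2^-1 * s) = - (n%:R / 2) + (n%:R - s) / 2)%R by ring.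
rewrite expRD ler_wpM2l ?expR_ge0//.
by apply: le_trans (expR_ge1Dx _); lra.
Qed.

End ball_bound.

(** * Information across the channel *)

Section kl.
Local Open Scope ereal_scope.
Context d (T : measurableType d) (R : realType).

(** Compare positive and negative parts separately. This form is needed because the log-likelihood
    ratio ln (w / v) is not known to be integrable. *)
Lemma le_integral_measurable (m : {measure set T -> \bar R}) (f g : T -> \bar R) :
  measurable_fun setT f -> measurable_fun setT g -> (forall x, f x <= g x) ->
  \int[m]_x f x <= \int[m]_x g x.
Proof.
move=> mf mg fg; rewrite integralE [leRHS]integralE; apply: leeB.
  apply: ge0_le_integral => //; [exact: measurable_funepos|exact: measurable_funepos|].
  by move=> x _; rewrite !funeposE ge_max !le_max fg lexx orbT.
apply: ge0_le_integral => //; [exact: measurable_funeneg|exact: measurable_funeneg|].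
by move=> x _; rewrite !funenegE ge_max !le_max leeN2 fg lexx orbT.
Qed.

Lemma measurable_inv_gt0 (f : T -> R) : measurable_fun setT f -> (forall x, (0 < f x)%R) ->
  measurable_fun setT (fun x => (f x)^-1)%R.
Proof.
move=> mf f0.
rewrite (_ : (fun x => _) = (fun x => f x `^ (-1)))%R.
  exact: (measurableT_comp (measurable_powR (-1)%R) mf).
by apply/funext => x; rewrite powR_inv1// ltW.
Qed.

Lemma measurable_div_gt0 (f g : T -> R) : measurable_fun setT f -> measurable_fun setT g ->
  (forall x, (0 < g x)%R) -> measurable_fun setT (fun x => f x / g x)%R.
Proof. by move=> mf mg g0; apply: measurable_funM => //; exact: measurable_inv_gt0. Qed.

Variables (P Q : probability T R) (m : {sigma_finite_measure set T -> \bar R}).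
Variables (w v u : T -> R).
Hypotheses (mw : measurable_fun setT w) (mv : measurable_fun setT v)
  (mu : measurable_fun setT u).
Hypotheses (w0 : forall x, (0 < w x)%R) (v0 : forall x, (0 < v x)%R)
  (u0 : forall x, (0 < u x)%R).
Hypothesis PE : forall A, measurable A -> P A = \int[m]_(x in A) (w x)%:E.
Hypothesis QE : forall A, measurable A -> Q A = \int[m]_(x in A) (v x)%:E.

Let PQE A : measurable A -> P A = \int[Q]_(x in A) (w x / v x)%:E.
Proof.
move=> mA; rewrite integral_mkcond.
have mv' : measurable_fun setT (fun x => (v x)%:E) by exact/measurable_EFinP.
rewrite (ge0_integral_density mv' QE); last 2 first.
- apply: (iffLR (measurable_restrictT _ mA)); apply: measurable_funTS.
  by apply/measurable_EFinP; exact: measurable_div_gt0.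
- by move=> x; rewrite patchE; case: ifP => // _; rewrite lee_fin divr_ge0// ltW.
rewrite PE// integral_mkcond; apply: eq_integral => x _.
by rewrite !patchE; case: ifP => _; rewrite ?mul0e// -EFinM divfK// gt_eqF.
Qed.

(* Integrate log (w / v) <= log (w / u) + (u / v - 1) against P: u plays the part of
   an arbitrary competitor of v. *)
Lemma kl_divergence_le (B : R) :
  \int[P]_x (u x / v x)%:E <= 1 ->
  P.-integrable setT (fun x => (ln (w x / u x))%:E) ->
  \int[P]_x (ln (w x / u x))%:E <= B%:E ->
  kl_divergence P Q <= (B / ln 2)%:E.
Proof.
move=> uv1 iwu wuB; have l2 : (0 < ln 2 :> R)%R by rewrite ln_gt0// ltr1n.
have l2' : (0 <= (ln 2)^-1 :> R)%R by rewrite invr_ge0 ltW.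
have wv0 x : 0 <= (w x / v x)%:E by rewrite lee_fin divr_ge0// ltW.
have mwv : measurable_fun setT (fun x => (w x / v x)%:E).
  by apply/measurable_EFinP; exact: measurable_div_gt0.
have dom : P `<< Q := density_dominates mwv PQE.
have RN := Radon_Nikodym_density mwv PQE.
rewrite /kl_divergence asboolT//.
have mln (f : T -> R) : measurable_fun setT f -> measurable_fun setT (fun x => (ln (f x) / ln 2)%:E).
  move=> mf; apply/measurable_EFinP; apply: measurable_funM => //.
  exact: (measurableT_comp (@measurable_ln R) mf).
have mRN : measurable_fun setT
    (fun x => fine (Radon_Nikodym (charge_of_finite_measure P) Q x)).
  by apply: (measurableT_comp (f := fine)).
rewrite (ae_eq_integral (fun x => (ln (w x / v x) / ln 2)%:E)) //; last 3 first.
- exact: mln.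
- by apply: mln; exact: measurable_div_gt0.
(* The derivative equals w / v outside a Q-null set, which is P-null by domination. *)
- have /= [N [mN QN sN]] := RN.
  exists N; split => //.
    by move/null_content_dominatesP: dom; apply.
  move=> x /= nx; apply: sN => /= RNx; apply: nx => _.
  by rewrite /log2 RNx.
have iu : P.-integrable setT (fun x => (u x / v x)%:E).
  apply/integrableP; split; first by apply/measurable_EFinP; exact: measurable_div_gt0.
  under eq_integral do rewrite gee0_abs ?lee_fin ?divr_ge0 ?ltW//.
  exact: le_lt_trans uv1 (ltry _).
have i1 : P.-integrable setT (cst 1) by exact: finite_measure_integrable_cst.
have iuv : P.-integrable setT (fun x => (u x / v x - 1)%:E).
  exact: (integrableB measurableT iu i1).
apply: (@le_trans _ _ (\int[P]_x ((ln 2)^-1%:E * ((ln (w x / u x))%:E + (u x / v x - 1)%:E)))).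
  apply: le_integral_measurable.
  - by apply: mln; exact: measurable_div_gt0.
  - apply: measurable_funeM; apply: emeasurable_funD; [exact: measurable_int iwu|exact: measurable_int iuv].
  move=> x; rewrite -EFinD -EFinM lee_fin mulrC ler_wpM2l//.
  have -> : (w x / v x = (w x / u x) * (u x / v x))%R.
    by field; rewrite !gt_eqF.
  rewrite lnM ?posrE ?divr_gt0// lerD2l.
  have h : (u x / v x = 1 + (u x / v x - 1))%R by rewrite addrC subrK.
  by rewrite [X in ln X]h le_ln1Dx// ltrBDr addNr divr_gt0.
rewrite integralZl//; last exact: integrableD.
rewrite integralD// mulrC EFinM; apply: lee_wpmul2l; first by rewrite lee_fin.
rewrite -[leRHS]adde0; apply: leeD => //.
have -> : \int[P]_x (u x / v x - 1)%:E = \int[P]_x (u x / v x)%:E - \int[P]_x cst 1 x.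
  by rewrite -(integralB measurableT iu i1).
by rewrite (integral_probability_cst P) leeBlDr// add0e.
Qed.

End kl.

Section channel_density.
Local Open Scope ereal_scope.
Context {R : realType} {n : nat}.
Notation V := ('cV[R]_n).
Variables (H : 'M[R]_n) (F : probability V R).
Notation gam := (@std_gaussian R n).
Notation inp := (@channel_input R n).
Notation out := (channel_output H).

Definition channel_density (p : V * V) : R := gaussian_pdf (p.2 - H *m p.1)%R.

Lemma channel_density_gt0 p : (0 < channel_density p)%R.
Proof. exact: gaussian_pdf_gt0. Qed.

Lemma measurable_channel_density : measurable_fun setT channel_density.
Proof.
rewrite (_ : channel_density = @gaussian_pdf R n \o channel_output (- H)).
  apply: measurableT_comp; first exact: measurable_gaussian_pdf.
  exact: (@measurable_funPT _ _ _ _ (channel_output (- H))).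
by apply/funext => p; rewrite /channel_density /channel_output/= mulNmx addrC.
Qed.

(** For a fixed input x, the translation y = H x + z turns the noise density at z into the
    transition density at y. *)
Lemma integral_channel (k : V * V -> \bar R) :
  measurable_fun setT k -> (forall p, 0 <= k p) ->
  \int[(F \x gam)]_p k (p.1, out p) =
  \int[(F \x vol n)]_p (k p * (channel_density p)%:E).
Proof.
move=> mk k0.
have mout : measurable_fun setT (fun p : V * V => (p.1, out p)).
  apply: measurable_fun_pair; first exact: measurable_fst.
  exact: (@measurable_funPT _ _ _ _ out).
have mkout : measurable_fun setT (fun p : V * V => k (p.1, out p)).
  exact: (measurableT_comp mk mout).
have mkw : measurable_fun setT (fun p => k p * (channel_density p)%:E).
  by apply: emeasurable_funM => //; apply/measurable_EFinP; exact: measurable_channel_density.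
have kw0 p : 0 <= k p * (channel_density p)%:E.
  by rewrite mule_ge0// lee_fin ltW// channel_density_gt0.
have kout0 (p : V * V) : 0 <= k (p.1, out p) by exact: k0.
rewrite (@fubini_tonelli1 _ _ _ _ _ F gam _ mkout kout0).
rewrite (@fubini_tonelli1 _ _ _ _ _ F (vol n) _ mkw kw0).
apply: eq_integral => x _; rewrite /fubini_F.
have mz : measurable_fun setT (fun z : V => k (x, H *m x + z)%R).
  exact: (measurableT_comp mkout (measurable_pair1 x)).
have mg : measurable_fun setT (fun z : V => k (x, H *m x + z)%R * (gaussian_pdf z)%:E).
  apply: emeasurable_funM; first exact: mz.
  by apply/measurable_EFinP; exact: measurable_gaussian_pdf.
transitivity (\int[gam]_z k (x, H *m x + z)%R); first by [].
rewrite (integral_gaussianE mz); last by move=> z; exact: k0.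
rewrite -(integral_vol_translate (- (H *m x))%R mg); last first.
  by move=> z; rewrite mule_ge0// lee_fin ltW// gaussian_pdf_gt0.
by apply: eq_integral => y _; rewrite /channel_density/= addrCA subrr addr0.
Qed.

Definition output_density (y : V) : R := fine (\int[F]_x (channel_density (x, y))%:E).

(** The Gaussian density is bounded by its peak, so its mixture over F is finite and [fine] loses
    nothing. *)
Lemma output_densityE y :
  (output_density y)%:E = \int[F]_x (channel_density (x, y))%:E.
Proof.
rewrite /output_density fineK// ge0_fin_numE; last first.
  by apply: integral_ge0 => x _; rewrite lee_fin ltW// channel_density_gt0.
apply: (@le_lt_trans _ _ (\int[F]_x (normal_peak 1 ^+ n)%:E)).
  apply: ge0_le_integral => //.
  - by move=> x _; rewrite lee_fin ltW// channel_density_gt0.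
  - apply/measurable_EFinP.
    exact: (measurableT_comp measurable_channel_density (measurable_pair2 y)).
  - move=> x _; rewrite lee_fin /channel_density /gaussian_pdf ler_piMr//.
      by rewrite exprn_ge0// normal_peak_ge0.
    by rewrite -expR0 ler_expR oppr_le0 mulr_ge0// sqr_ge0.
by rewrite integral_probability_cst ltry.
Qed.

(** A vanishing integral of a positive function would make the whole space F-null. *)
Lemma output_density_gt0 y : (0 < output_density y)%R.
Proof.
rewrite -lte_fin output_densityE lt_neqAle; apply/andP; split; last first.
  by apply: integral_ge0 => x _; rewrite lee_fin ltW// channel_density_gt0.
apply/eqP => /esym I0.
have mw : measurable_fun setT (fun x => (channel_density (x, y))%:E).
  apply/measurable_EFinP.
  exact: (measurableT_comp measurable_channel_density (measurable_pair2 y)).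
have : \int[F]_x `|(channel_density (x, y))%:E| = 0.
  rewrite -[RHS]I0; apply: eq_integral => x _.
  by rewrite gee0_abs// lee_fin ltW// channel_density_gt0.
move/(ae_eq_integral_abs F measurableT mw) => [N [mN FN sN]].
have : F N = 1.
  rewrite (_ : N = setT); first exact: probability_setT.
  apply/seteqP; split => // x _; apply: sN => /= /(_ I) [] /eqP.
  by rewrite gt_eqF// channel_density_gt0.
by rewrite FN => /eqP; rewrite eq_sym onee_eq0.
Qed.

Lemma measurable_output_density : measurable_fun setT output_density.
Proof.
apply: measurableT_comp => //.
apply: (@measurable_fun_fubini_tonelli_G _ _ _ _ _ F (fun p => (channel_density p)%:E)).
  by apply/measurable_EFinP; exact: measurable_channel_density.
by move=> p; rewrite lee_fin ltW// channel_density_gt0.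
Qed.

Lemma integral_output (k : V -> \bar R) :
  measurable_fun setT k -> (forall y, 0 <= k y) ->
  \int[(F \x gam)]_p k (out p) = \int[vol n]_y (k y * (output_density y)%:E).
Proof.
move=> mk k0.
have mk2 : measurable_fun setT (fun p : V * V => k p.2).
  exact: (measurableT_comp mk measurable_snd).
rewrite (integral_channel mk2)// fubini_tonelli2; last 2 first.
- by apply: emeasurable_funM => //; apply/measurable_EFinP; exact: measurable_channel_density.
- by move=> p; rewrite mule_ge0// lee_fin ltW// channel_density_gt0.
apply: eq_integral => y _; rewrite /fubini_G/= ge0_integralZl//.
- by rewrite output_densityE.
- apply/measurable_EFinP.
  exact: (measurableT_comp measurable_channel_density (measurable_pair2 y)).
- by move=> x _; rewrite lee_fin ltW// channel_density_gt0.
Qed.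

Notation joint := (distribution (F \x gam) (pair_RV inp out)).
Notation prodm := (distribution (F \x gam) inp \x distribution (F \x gam) out).

Lemma joint_densityE A : measurable A ->
  joint A = \int[(F \x vol n)]_(p in A) (channel_density p)%:E.
Proof.
move=> mA; rewrite integral_mkcond.
transitivity (\int[(F \x vol n)]_p ((\1_A p)%:E * (channel_density p)%:E)); last first.
  by apply: eq_integral => p _; rewrite patchE indicE; case: (p \in A); rewrite ?mul1e ?mul0e.
rewrite -(integral_channel (k := fun p => (\1_A p)%:E)); last 2 first.
- by apply/measurable_EFinP; exact: measurable_indic.
- by move=> p; rewrite lee_fin.
have mout : measurable_fun setT (fun p : V * V => (p.1, out p)).
  apply: measurable_fun_pair; first exact: measurable_fst.
  exact: (@measurable_funPT _ _ _ _ out).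
have mB : measurable ((fun p : V * V => (p.1, out p)) @^-1` A).
  by rewrite -[X in measurable X]setTI; exact: mout.
transitivity (\int[(F \x gam)]_p (\1_((fun p : V * V => (p.1, out p)) @^-1` A) p)%:E); last by [].
by rewrite integral_indic// setIT.
Qed.

Lemma integral_distribution_out (k : V -> \bar R) :
  measurable_fun setT k -> (forall y, 0 <= k y) ->
  \int[distribution (F \x gam) out]_y k y =
  \int[vol n]_y (k y * (output_density y)%:E).
Proof.
move=> mk k0; rewrite -integral_output//.
have mo : measurable_fun setT out by exact: (@measurable_funPT _ _ _ _ out).
rewrite [LHS](@ge0_integral_pushforward _ _ _ _ _ out mo (F \x gam) setT k measurableT mk).
  by rewrite preimage_setT.
by move=> y _; exact: k0.
Qed.

Lemma integral_distribution_in (k : V -> \bar R) :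
  measurable_fun setT k -> (forall y, 0 <= k y) ->
  \int[distribution (F \x gam) inp]_x k x = \int[F]_x k x.
Proof.
move=> mk k0.
rewrite [LHS](@ge0_integral_pushforward _ _ _ _ _ inp measurable_fst (F \x gam) setT k measurableT mk).
  have mk1 : measurable_fun setT (fun p : V * V => k p.1).
    exact: (measurableT_comp mk measurable_fst).
  rewrite preimage_setT (@fubini_tonelli1 _ _ _ _ _ F gam _ mk1 (fun p => k0 p.1)).
  by apply: eq_integral => x _; rewrite /fubini_F /= integral_probability_cst.
by move=> y _; exact: k0.
Qed.

Lemma product_densityE A : measurable A ->
  prodm A = \int[(F \x vol n)]_(p in A) (output_density p.2)%:E.
Proof.
move=> mA; rewrite integral_mkcond.
pose f p : \bar R := (\1_A p)%:E.
have mf : measurable_fun setT f.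
  by apply/measurable_EFinP; exact: measurable_indic.
have f0 p : 0 <= f p by rewrite lee_fin.
have mg : measurable_fun setT (fun p : V * V => f p * (output_density p.2)%:E).
  apply: emeasurable_funM => //; apply/measurable_EFinP.
  exact: (measurableT_comp measurable_output_density measurable_snd).
have g0 p : 0 <= f p * (output_density p.2)%:E.
  by rewrite mule_ge0// lee_fin ltW// output_density_gt0.
transitivity (\int[(F \x vol n)]_p (f p * (output_density p.2)%:E)); last first.
  by apply: eq_integral => p _; rewrite patchE /f indicE; case: (p \in A); rewrite ?mul1e ?mul0e.
transitivity (\int[prodm]_p f p).
  have := integral_indic prodm measurableT mA.
  rewrite setIT => I1.
  exact: (esym I1).
rewrite (@fubini_tonelli1 _ _ _ _ _ F (vol n) _ mg g0).
rewrite (@fubini_tonelli1 _ _ _ _ _ (distribution (F \x gam) inp) (distribution (F \x gam) out) _ mf f0).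
rewrite integral_distribution_in; last 2 first.
- exact: (@measurable_fun_fubini_tonelli_F _ _ _ _ _ (distribution (F \x gam) out) _ mf f0).
- by move=> x; apply: integral_ge0 => y _; exact: f0.
apply: eq_integral => x _; rewrite /fubini_F integral_distribution_out//.
exact: (measurableT_comp mf (measurable_pair1 x)).
Qed.

End channel_density.

Section product_with_probability.
Local Open Scope ereal_scope.
Context d1 d2 (T1 : measurableType d1) (T2 : measurableType d2) (R : realType).
Variables (P : probability T1 R) (mu : {sigma_finite_measure set T2 -> \bar R}).

(* The library registers the product of sigma-finite measures as sigma-finite only
   after that of finite measures, which shadows it in canonical inference. *)
Definition probability_product : set (T1 * T2) -> \bar R := (P \x mu)%E.

HB.instance Definition _ := Measure.on probability_product.

Let probability_product_sigma_finite : sigma_finite setT probability_product.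
Proof.
have [G GT mG] := sigma_finiteT mu.
exists (fun k => setT `*` G k) => [|k].
  apply/seteqP; split => // -[x y] _.
  have : (\bigcup_k G k) y by rewrite -GT.
  by move=> [k _ Gky]; exists k.
have [mGk Gk] := mG k; split; first exact: measurableX.
rewrite /probability_product product_measure1E//.
by rewrite [X in X * _](_ : _ = 1) ?mul1e//; exact: probability_setT.
Qed.

HB.instance Definition _ := Measure_isSigmaFinite.Build _ _ _ probability_product
  probability_product_sigma_finite.

End product_with_probability.

(** * The test density q and the bound on the mutual information *)

Section information_bound.
Local Open Scope ereal_scope.
Context {R : realType}.

(** Shaped after the logarithm of phi / q: for the term added with a >= 0 an upper bound on the mean
    is enough, while the subtracted term comes with its exact mean. *)
Lemma integral_cst_addB_le d (T : measurableType d) (P : probability T R)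
    (f g : T -> R) (k a b M m : R) :
  measurable_fun setT f -> measurable_fun setT g ->
  (forall x, 0 <= f x)%R -> (forall x, 0 <= g x)%R -> (0 <= a)%R ->
  \int[P]_x (f x)%:E <= M%:E -> \int[P]_x (g x)%:E = m%:E ->
  P.-integrable setT (fun x => (k + a * f x - b * g x)%:E) /\
  \int[P]_x (k + a * f x - b * g x)%:E <= (k + a * M - b * m)%:E.
Proof.
move=> mf mg f0 g0 a0 fM gm.
have If : P.-integrable setT (fun x => (f x)%:E).
  apply/integrableP; split; first exact/measurable_EFinP.
  under eq_integral do rewrite gee0_abs ?lee_fin//.
  exact: le_lt_trans fM (ltry _).
have Ig : P.-integrable setT (fun x => (g x)%:E).
  apply/integrableP; split; first exact/measurable_EFinP.
  under eq_integral do rewrite gee0_abs ?lee_fin//.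
  by rewrite gm ltry.
have Ik : P.-integrable setT (cst k%:E) by exact: finite_measure_integrable_cst.
have Iaf := integrableZl measurableT a If.
have Ibg := integrableZl measurableT b Ig.
have Ikf := integrableD measurableT Ik Iaf.
have I3 := integrableB measurableT Ikf Ibg.
have E x : (k + a * f x - b * g x)%:E = k%:E + a%:E * (f x)%:E - b%:E * (g x)%:E.
  by rewrite EFinB EFinD !EFinM.
split; first by apply: eq_integrable I3 => // x _; rewrite E.
under eq_integral do rewrite E.
rewrite (integralB measurableT Ikf Ibg) (integralD measurableT Ik Iaf).
rewrite (integralZl measurableT If) (integralZl measurableT Ig) gm.
rewrite integral_probability_cst EFinB EFinD !EFinM.
by apply: leeB => //; apply: leeD => //; apply: lee_wpmul2l; rewrite ?lee_fin.
Qed.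

Context {n : nat}.
Notation V := ('cV[R]_n).
Variables (H : 'M[R]_n) (F : probability V R) (r : R).
Hypothesis n0 : (0 < n)%N.
Hypothesis r0 : (0 <= r)%R.
Hypothesis Fr : {ae F, forall x, (euclidean_norm (H *m x) <= r)%R}.
Hypothesis ball0 : (0 < unit_ball_vol (R := R) n)%R.
Notation gam := (@std_gaussian R n).
Notation inp := (@channel_input R n).
Notation out := (channel_output H).
Notation joint := (distribution (F \x gam) (pair_RV inp out)).
Notation prodm := (distribution (F \x gam) inp \x distribution (F \x gam) out).

Let S : R := (r ^+ 2 + n%:R + 2)%R.
(** The minimiser of s^4 S^2 - n ln s, the part of the bound that depends on s. *)
Let s : R := expR (ln (n%:R / (4 * S ^+ 2)) / 4).
(** An upper bound for s^n times the integral of exp (- (s |y|)^4), so that [q] has mass at most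
    1. *)
Let c : R := (unit_ball_vol n * quartic_bound n)%R.
Let q (y : V) : R := (s ^+ n / c * expR (- (s * euclidean_norm y) ^+ 4))%R.

Let S0 : (0 < S)%R.
Proof. by rewrite /S ltr_wpDl// addr_ge0// sqr_ge0. Qed.

Let s0 : (0 < s)%R. Proof. exact: expR_gt0. Qed.

Let c0 : (0 < c)%R. Proof. by rewrite mulr_gt0// expR_gt0. Qed.

Let s4 : (s ^+ 4 = n%:R / (4 * S ^+ 2))%R.
Proof.
rewrite /s -expRM_natl mulrC divfK// lnK// posrE divr_gt0 ?ltr0n//.
by rewrite mulr_gt0// exprn_gt0.
Qed.

Let q0 y : (0 < q y)%R.
Proof. by rewrite mulr_gt0 ?expR_gt0// divr_gt0// exprn_gt0. Qed.

Let mq : measurable_fun setT q.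
Proof.
apply: measurable_funM => //; apply: measurableT_comp => //.
apply: measurableT_comp => //; apply: measurable_funX; apply: measurable_funM => //.
exact: measurable_euclidean_norm.
Qed.

Let integral_q : \int[vol n]_y (q y)%:E <= 1.
Proof.
have me : measurable_fun setT (fun y : V => (expR (- (s * euclidean_norm y) ^+ 4))%:E).
  apply/measurable_EFinP; apply: measurableT_comp => //.
  apply: measurableT_comp => //; apply: measurable_funX; apply: measurable_funM => //.
  exact: measurable_euclidean_norm.
have s1 : (0 <= s ^+ n / c)%R by rewrite ltW// divr_gt0// exprn_gt0.
under eq_integral do rewrite /q EFinM.
rewrite ge0_integralZl_EFin//.
have := integral_quartic_le n0 s0; rewrite -/c => h.
rewrite mulrC EFinM -muleA.
have c1 : 0 <= (c^-1)%:E by rewrite lee_fin invr_ge0 ltW.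
apply: le_trans (lee_wpmul2l c1 h) _.
by rewrite -EFinM mulVf// gt_eqF.
Qed.

Let fourth_moment :
  \int[(F \x gam)]_p (euclidean_norm (out p) ^+ 4)%:E <= (S ^+ 2)%:E.
Proof.
have mo4 : measurable_fun setT (fun p : V * V => (euclidean_norm (out p) ^+ 4)%:E).
  apply/measurable_EFinP; apply: measurable_funX; apply: measurableT_comp.
    exact: measurable_euclidean_norm.
  exact: (@measurable_funPT _ _ _ _ out).
have o40 (p : V * V) : 0 <= (euclidean_norm (out p) ^+ 4)%:E.
  by rewrite lee_fin exprn_even_ge0.
rewrite (@fubini_tonelli1 _ _ _ _ _ F gam _ mo4 o40).
rewrite -[leRHS](integral_probability_cst F); apply: ae_ge0_le_integral => //.
- by move=> x _; apply: integral_ge0 => z _.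
- exact: (@measurable_fun_fubini_tonelli_F _ _ _ _ _ gam _ mo4 o40).
- by move=> x _; rewrite lee_fin sqr_ge0.
case: Fr => N [mN FN sN]; exists N; split => // x /= nx; apply: sN => /= xr; apply: nx => _.
rewrite /fubini_F (gaussian_shift4 (H *m x)%R) lee_fin /S.
have : (euclidean_norm (H *m x) ^+ 2 <= r ^+ 2)%R.
  by rewrite lerXn2r// nnegrE// euclidean_norm_ge0.
have := sqr_ge0 (euclidean_norm (H *m x)).
have n1 : (1 <= n%:R :> R)%R by rewrite ler1n.
set t := (euclidean_norm (H *m x) ^+ 2)%R => t0 tr.
(* The square exceeds the fourth moment by 2n + 4. *)
apply: (@le_trans _ _ ((t + n%:R + 2) ^+ 2)%R); first by nra.
by rewrite lerXn2r ?nnegrE ?addr_ge0 ?sqr_ge0// !lerD2r.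
Qed.

Let second_moment :
  \int[(F \x gam)]_p (euclidean_norm p.2 ^+ 2)%:E = n%:R%:E.
Proof.
have m2 : measurable_fun setT (fun p : V * V => (euclidean_norm p.2 ^+ 2)%:E).
  apply/measurable_EFinP; apply: measurable_funX; apply: measurableT_comp => //.
  exact: measurable_euclidean_norm.
have n20 (p : V * V) : 0 <= (euclidean_norm p.2 ^+ 2)%:E by rewrite lee_fin sqr_ge0.
rewrite (@fubini_tonelli1 _ _ _ _ _ F gam _ m2 n20).
rewrite -[RHS](integral_probability_cst F); apply: eq_integral => x _.
rewrite /fubini_F /=; have := @gaussian_shift2 R n 0%R.
rewrite euclidean_norm_sqr big1 ?add0r => [<-|i _]; last by rewrite mxE expr0n.
by apply: eq_integral => z _; rewrite add0r.
Qed.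

Let k : R := (n%:R * ln (normal_peak 1) + ln c - n%:R * ln s)%R.

Let log_ratio (p : V * V) :
  ln (gaussian_pdf p.2 / q (out p)) =
  (k + s ^+ 4 * euclidean_norm (out p) ^+ 4 - 2^-1 * euclidean_norm p.2 ^+ 2)%R.
Proof.
have pk : (0 < normal_peak 1 :> R)%R by rewrite normal_peak_gt0 ?oner_neq0.
have ln_mul_expR (a x : R) : (0 < a -> ln (a * expR x) = ln a + x)%R.
  by move=> a0; rewrite lnM ?posrE ?expR_gt0// expRK.
have pkn : (0 < normal_peak 1 ^+ n :> R)%R by rewrite exprn_gt0.
have sn : (0 < s ^+ n)%R by rewrite exprn_gt0.
rewrite ln_div ?posrE ?gaussian_pdf_gt0// /gaussian_pdf /q.
rewrite (ln_mul_expR _ _ pkn) (ln_mul_expR _ _ (divr_gt0 sn c0)).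
rewrite (ln_div sn c0).
rewrite (ln_exprn n pk) (ln_exprn n s0) /k exprMn.
move: (ln (normal_peak 1)) (ln c) (ln s) (s ^+ 4)%R => a b e f.
ring.
Qed.

Let measurable_noise2 :
  measurable_fun setT (fun p : V * V => euclidean_norm p.2 ^+ 2)%R.
Proof.
apply: measurable_funX; apply: measurableT_comp => //.
exact: measurable_euclidean_norm.
Qed.

Let measurable_out4 :
  measurable_fun setT (fun p : V * V => euclidean_norm (out p) ^+ 4)%R.
Proof.
apply: measurable_funX; apply: measurableT_comp.
  exact: measurable_euclidean_norm.
exact: (@measurable_funPT _ _ _ _ out).
Qed.

Let log_ratio_integral :
  (F \x gam).-integrable setT (fun p => (ln (gaussian_pdf p.2 / q (out p)))%:E) /\
  \int[(F \x gam)]_p (ln (gaussian_pdf p.2 / q (out p)))%:E <=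
    (k + s ^+ 4 * S ^+ 2 - 2^-1 * n%:R)%:E.
Proof.
have s40 : (0 <= s ^+ 4)%R by rewrite exprn_even_ge0.
have o40 (p : V * V) : (0 <= euclidean_norm (out p) ^+ 4)%R by rewrite exprn_even_ge0.
have n20 (p : V * V) : (0 <= euclidean_norm p.2 ^+ 2)%R by rewrite sqr_ge0.
have [I1 I2] := integral_cst_addB_le k 2^-1 measurable_out4 measurable_noise2 o40 n20
  s40 fourth_moment second_moment.
split; first by apply: eq_integrable I1 => // p _; rewrite log_ratio.
by under eq_integral do rewrite log_ratio.
Qed.

(** The terms (n/4) (ln n - ln 4) of - n ln s and of ln c cancel, leaving (n/2) ln S. Since s^4 S^2
    = n/4, the plain multiples of n add up to n/4 - n/4 - n/2. *)
Let bound_value : (k + s ^+ 4 * S ^+ 2 - 2^-1 * n%:R =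
  ln (unit_ball_vol n) + (ln (pi * n%:R) + n%:R * (ln S - ln (2 * pi) - 1)) / 2)%R.
Proof.
have nR : (0 < n%:R :> R)%R by rewrite ltr0n.
have S2 : (0 < S ^+ 2)%R by rewrite exprn_gt0.
have f4 : (0 < 4 :> R)%R by [].
have lns : (ln s = (ln n%:R - (ln 4 + 2 * ln S)) / 4)%R.
  by rewrite /s expRK (ln_div nR (mulr_gt0 f4 S2)) (lnM f4 S2) ln_exprn.
have lnc : (ln c = ln (unit_ball_vol n) +
    (ln (pi * n%:R) + n%:R / 2 * (ln n%:R - ln 4 - 1)) / 2)%R.
  by rewrite /c (lnM ball0 (expR_gt0 _)) /quartic_bound expRK (ln_div nR f4).
rewrite s4 /k ln_normal_peak lns lnc.
move: (ln (unit_ball_vol n)) (ln S) (ln 4) (ln (2 * pi)%R) (ln (pi * n%:R)%R) (ln n%:R).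
by move=> a1 a2 a3 a4 a5 a6; field; rewrite gt_eqF.
Qed.

Lemma channel_information_le : channel_information H F <=
  ((ln (unit_ball_vol n) + (ln (pi * n%:R) +
    n%:R * (ln (r ^+ 2 + n%:R + 2) - ln (2 * pi) - 1)) / 2) / ln 2)%:E.
Proof.
have mpair : measurable_fun setT (pair_RV inp out).
  exact: (@measurable_funPT _ _ _ _ (pair_RV inp out)).
have mw := measurable_channel_density H.
have mv : measurable_fun setT (fun p : V * V => output_density H F p.2).
  exact: (measurableT_comp (measurable_output_density H F) measurable_snd).
have mu : measurable_fun setT (fun p : V * V => q p.2).
  exact: (measurableT_comp mq measurable_snd).
(* Seen from the pair (x, z), the shift H x cancels and the transition density becomes that of the
   noise. *)
have out_ratio p : channel_density H (pair_RV inp out p) = gaussian_pdf p.2.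
  by rewrite /channel_density /pair_RV /channel_input /channel_output/= addrC addKr.
have mlr : measurable_fun setT (fun p : V * V => (ln (channel_density H p / q p.2))%:E).
  apply/measurable_EFinP; apply: (measurableT_comp (@measurable_ln R)).
  by apply: measurable_div_gt0; [exact: mw|exact: mu|move=> p; exact: q0].
rewrite /channel_information /mutual_information -bound_value.
have KL := kl_divergence_le (m := probability_product F (vol n)) mw mv mu (channel_density_gt0 H)
  (fun p => output_density_gt0 H F p.2) (fun p => q0 p.2)
  (joint_densityE H F) (product_densityE H F).
have [L1 L2] := log_ratio_integral.
have L1' : (F \x gam).-integrable (pair_RV inp out @^-1` setT)
    ((fun p : V * V => (ln (channel_density H p / q p.2))%:E) \o pair_RV inp out).
  rewrite preimage_setT; apply: eq_integrable L1 => [|p _]; first exact: measurableT.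
  by rewrite /= out_ratio.
apply: KL.
(* Under the law of the output, the mean of [q] over the output density is the integral of [q],
   which is at most 1. *)
- have md : measurable_fun setT (fun y => (q y / output_density H F y)%:E).
    apply/measurable_EFinP; apply: measurable_div_gt0.
    - exact: mq.
    - exact: measurable_output_density.
    - exact: output_density_gt0.
  have d0 y : 0 <= (q y / output_density H F y)%:E.
    by rewrite lee_fin divr_ge0// ltW// output_density_gt0.
  rewrite (@ge0_integral_pushforward _ _ _ _ _ _ mpair (F \x gam) setT
    (fun p => (q p.2 / output_density H F p.2)%:E) measurableT); last 2 first.
  + exact: (measurableT_comp md measurable_snd).
  + by move=> p _; exact: d0.
  rewrite preimage_setT [leLHS](integral_output H F md d0).
  apply: le_trans integral_q; rewrite le_eqVlt; apply/orP; left; apply/eqP.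
  apply: eq_integral => y _; rewrite -EFinM divfK// gt_eqF//.
  exact: output_density_gt0.
- exact: (integrable_pushforward mpair mlr L1' measurableT).
- rewrite (integral_pushforward mpair mlr L1' measurableT) preimage_setT.
  apply: le_trans L2; rewrite le_eqVlt; apply/orP; left; apply/eqP.
  by apply: eq_integral => p _; rewrite /= out_ratio.
Qed.

End information_bound.

(** * Compact sets and the comparison with C_EPI *)

Section compact_sets.
Context {R : realType} {n : nat}.

(** These are balls of the sup norm, hence boxes. *)
Lemma measurable_ball_cV (x : 'cV[R]_n) (e : R) : measurable (ball x e).
Proof.
have [e0|e0] := leP e 0.
  rewrite (_ : ball x e = set0)//; apply/seteqP; split => // y [].
  by rewrite ltNge e0.
rewrite (_ : ball x e = [set y | forall i, ball (x i ord0) e (y i ord0)]).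
  by apply: (@measurable_rect R n (fun i => ball (x i ord0) e)) => i; exact: measurable_ball.
apply/seteqP; split => y /=.
  by move=> [_ xy] i; exact: xy.
by move=> xy; split => // i j; rewrite (ord1 j); exact: xy.
Qed.

(** The sigma-algebra is generated by coordinates rather than by open sets. By compactness, X is
    covered for each k by finitely many boxes of radius 1/(k+1) centred in X; a point in all of
    these unions lies in the closure of X, which is X. *)
Lemma compact_measurable_cV (X : set 'cV[R]_n) : compact X -> measurable X.
Proof.
move=> cX.
have HD k : exists D : set 'cV[R]_n, [/\ finite_set D, D `<=` X &
    X `<=` \bigcup_(x in D) ball x k.+1%:R^-1].
  move: (cX); rewrite compact_cover => /(_ _ X (fun x => ball x k.+1%:R^-1)).
  case.
  - by move=> x Xx; apply: ball_open; rewrite invr_gt0.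
  - by move=> x Xx; exists x => //; apply: ballxx; rewrite invr_gt0.
  move=> D sub cov; eexists; split; last exact: cov; first exact: finite_fset.
  by move=> x /sub /set_mem.
pose D k := sval (cid (HD k)).
have DX k : [/\ finite_set (D k), D k `<=` X & X `<=` \bigcup_(x in D k) ball x k.+1%:R^-1].
  exact: svalP (cid (HD k)).
rewrite (_ : X = \bigcap_k \bigcup_(x in D k) ball x k.+1%:R^-1).
  apply: bigcapT_measurable => k; have [fD _ _] := DX k.
  by apply: fin_bigcup_measurable => // x _; exact: measurable_ball_cV.
apply/seteqP; split => [x Xx k _|y Xy]; first by have [_ _ /(_ x Xx)] := DX k.
have /closure_id -> : closed X.
  by apply: compact_closed cX; exact: norm_hausdorff.
move=> B /nbhs_ballP[e /= e0 yB].
have [k ke] : exists k : nat, k.+1%:R^-1 < e.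
  by have [k _ /(_ _ (leqnn k))] := near_infty_natSinv_lt (PosNum e0); exists k.
have [x /= xD xy] := Xy k I; exists x; split.
  by have [_ /(_ _ xD)] := DX k.
by apply: yB; apply: ball_sym; apply: le_ball xy; exact: ltW.
Qed.

Lemma compact_euclidean_bounded (X : set 'cV[R]_n) (H : 'M[R]_n) : compact X ->
  exists2 b : R, 0 <= b & forall x, X x -> euclidean_norm (H *m x) <= b.
Proof.
move=> /compact_bounded[M0 [_ /(_ (Num.max M0 0 + 1))]].
rewrite ltr_pwDr// ?le_max ?lexx// => /(_ isT) XM.
set M := _ + 1 in XM.
exists (Num.sqrt (\sum_i (\sum_j `|H i j| * M) ^+ 2)); first exact: sqrtr_ge0.
move=> x /XM xM; rewrite ler_sqrt ?sumr_ge0// => [|i _]; last by rewrite sqr_ge0.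
have M0' : 0 <= M by exact: le_trans xM.
apply: ler_sum => i _; rewrite -real_normK ?num_real// lerXn2r ?nnegrE//.
  by rewrite sumr_ge0// => j _; rewrite mulr_ge0.
rewrite mxE; apply: le_trans (ler_norm_sum _ _ _) _; apply: ler_sum => j _.
rewrite normrM ler_wpM2l//; apply: le_trans xM.
rewrite [leRHS]/Num.norm/= mx_normrE.
exact: (le_bigmax _ (fun ij : 'I_n * 'I_1 => `|x ij.1 ij.2|) (j, ord0)).
Qed.

(** The norm of each point of S is a lower bound of the admissible radii, so their infimum is
    admissible too. *)
Lemma r_max_le (S : set 'cV[R]_n) (b : R) : 0 <= b -> S `<=` euclidean_ball b ->
  0 <= r_max S /\ S `<=` euclidean_ball (r_max S).
Proof.
move=> b0 Sb; have ne : [set r | 0 <= r /\ S `<=` euclidean_ball r] !=set0 by exists b.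
split; first by apply: lb_le_inf => // r [].
by move=> x Sx; apply: lb_le_inf => // r [_ /(_ _ Sx)].
Qed.

End compact_sets.

(** * Elementary comparison of the capacity bound with [C_EPI] *)

Section final_inequality.
Context {R : realType}.

Lemma ln_unit_ball_vol_le n : 0 < unit_ball_vol (R := R) n ->
  ln (unit_ball_vol (R := R) n) <= n%:R / 2 * (ln (2 * pi) + 1 - ln (n%:R + 2)).
Proof.
move=> w0; have := unit_ball_vol_le (R := R) n.
have n2 : 0 < n%:R + 2 :> R by rewrite ltr_wpDl.
have s0 : 0 < Num.sqrt (n%:R + 2) :> R by rewrite sqrtr_gt0.
have pk : 0 < normal_peak 1 :> R by rewrite normal_peak_gt0 ?oner_neq0.
have pn : 0 < normal_peak 1 ^+ n :> R by rewrite exprn_gt0.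
have sn : 0 < Num.sqrt (n%:R + 2) ^+ n :> R by rewrite exprn_gt0.
have e0 := expR_gt0 (- (n%:R / 2) : R).
rewrite -ler_ln ?posrE ?mulr_gt0// ln1 (lnM w0) ?posrE ?mulr_gt0//.
rewrite (lnM (mulr_gt0 pn e0) sn) (lnM pn e0) expRK !ln_exprn// ln_normal_peak.
have -> : ln (Num.sqrt (n%:R + 2)) = ln (n%:R + 2) / 2 :> R.
  by rewrite -[in RHS](sqr_sqrtr (ltW n2)) ln_exprn//; field.
move: (ln _) (ln _) (ln _) => a b c; lra.
Qed.

(** With W = w^(2/n), Rh = rho^(2/n) and a = v^(2/n) / (2 pi e), the definition of rho gives a Rh =
    W r^2 / (2 pi e) exactly. The rest, W (n + 2) / (2 pi e), is at most 1 <= Rh, and the two add up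
    to (1 + a) Rh. *)
Lemma capacity_bound_le (n : nat) (w r v : R) : (0 < n)%N -> 0 < w -> 0 < r -> 0 < v ->
  v <= w * r ^+ n ->
  ln w <= n%:R / 2 * (ln (2 * pi) + 1 - ln (n%:R + 2)) ->
  ln w + (ln (pi * n%:R) + n%:R * (ln (r ^+ 2 + n%:R + 2) - ln (2 * pi) - 1)) / 2 <=
  n%:R / 2 * ln (1 + v `^ (2 / n%:R) / (2 * pi * expR 1)) +
  n%:R / 2 * ln ((pi * n%:R) `^ (1 / n%:R) * (w * r ^+ n / v) `^ (2 / n%:R)).
Proof.
move=> n0 w0 r0 v0 vw lw.
have nR : 0 < n%:R :> R by rewrite ltr0n.
have pn : 0 < pi * n%:R :> R by rewrite mulr_gt0// pi_gt0.
have p2 : 0 < 2 * pi :> R by rewrite mulr_gt0// pi_gt0.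
have c0 : 0 < 2 * pi * expR 1 :> R by rewrite mulr_gt0// expR_gt0.
have rho0 : 0 < w * r ^+ n / v by rewrite divr_gt0// mulr_gt0// exprn_gt0.
set rho := w * r ^+ n / v in rho0 *.
pose W := w `^ (2 / n%:R); pose Rh := rho `^ (2 / n%:R).
have W0 : 0 < W by exact: powR_gt0.
have Rh0 : 0 < Rh by exact: powR_gt0.
have rho1 : 1 <= rho by rewrite ler_pdivlMr// mul1r.
have Rh1 : 1 <= Rh.
  rewrite -(@ler_ln R) ?posrE// ln1 ln_powR; apply: mulr_ge0; last exact: ln_ge0.
  by rewrite divr_ge0// ltW.
have S0 : 0 < r ^+ 2 + n%:R + 2 by rewrite ltr_wpDl// addr_ge0 ?sqr_ge0// ltW.
set a := v `^ (2 / n%:R) / (2 * pi * expR 1).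
have a0 : 0 < a by rewrite divr_gt0// powR_gt0.
have aRh : a * Rh = W * r ^+ 2 / (2 * pi * expR 1).
  rewrite /a mulrAC; congr (_ / _).
  rewrite /Rh -powRM ?ltW// /rho mulrCA mulfV ?mulr1 ?gt_eqF//.
  rewrite powRM ?ltW ?exprn_gt0//; congr (_ * _).
  rewrite -powR_mulrn ?ltW// -powRrM mulrCA mulfV ?gt_eqF// mulr1.
  by rewrite powR_mulrn// ltW.
have Wn : W * (n%:R + 2) <= 2 * pi * expR 1.
  have n2 : 0 < n%:R + 2 :> R by rewrite addr_gt0.
  rewrite -ler_ln ?posrE ?c0 ?(mulr_gt0 W0 n2)// (lnM W0 n2) (lnM p2 (expR_gt0 _)) expRK /W ln_powR.
  rewrite -lerBrDr mulrAC ler_pdivrMr//.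
  move: lw; move: (ln w) (ln _) (ln _) => x y z; nra.
have key : W * (r ^+ 2 + n%:R + 2) / (2 * pi * expR 1) <= (1 + a) * Rh.
  have -> : (1 + a) * Rh = Rh + a * Rh by ring.
  have -> : W * (r ^+ 2 + n%:R + 2) / (2 * pi * expR 1) =
    W * (n%:R + 2) / (2 * pi * expR 1) + W * r ^+ 2 / (2 * pi * expR 1) by ring.
  rewrite aRh lerD2r.
  by apply: le_trans Rh1; rewrite ler_pdivrMr// mul1r.
have lkey : ln W + ln (r ^+ 2 + n%:R + 2) - (ln (2 * pi) + 1) <= ln (1 + a) + ln Rh.
  have a1 : 0 < 1 + a by rewrite addr_gt0.
  have lc : ln (2 * pi * expR 1) = ln (2 * pi) + 1 :> R.
    by rewrite (lnM p2 (expR_gt0 _)) expRK.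
  rewrite -(lnM a1 Rh0) -(lnM W0 S0) -lc.
  by rewrite -(ln_div (mulr_gt0 W0 S0) c0) ler_ln ?posrE ?(divr_gt0 (mulr_gt0 W0 S0) c0) ?(mulr_gt0 a1 Rh0).
rewrite (lnM (powR_gt0 _ pn) Rh0) ln_powR.
have lW : ln w = n%:R / 2 * ln W.
  by rewrite /W ln_powR; field; rewrite gt_eqF.
rewrite [in leLHS]lW.
have h : n%:R / 2 * (ln W + ln (r ^+ 2 + n%:R + 2) - (ln (2 * pi) + 1)) <=
  n%:R / 2 * (ln (1 + a) + ln Rh) by rewrite ler_wpM2l// divr_ge0// ltW.
have -> : n%:R / 2 * (1 / n%:R * ln (pi * n%:R) + ln Rh) =
   ln (pi * n%:R) / 2 + n%:R / 2 * ln Rh by field; rewrite gt_eqF.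
move: h; move: (ln _) (ln _) (ln _) (ln _) (ln _) (ln _) => *; lra.
Qed.

End final_inequality.

Unset Implicit Arguments.
Set Strict Implicit.
Set Printing Implicit Defensive.

Theorem theorem8 (R : realType) (n : nat) (X : set 'cV[R]_n) (H : 'M[R]_n)
    (n_gt0 : (0 < n)%N) (convexX : convex_set X) (compactX : compact X)
    (X0 : X 0) (volX_gt0 : (0 < vol n X)%E) (rankH : \rank H = n) :
  (capacity X H - (C_EPI X H)%:E <=
   (n%:R / 2 * log2 ((pi * n%:R) `^ (1 / n%:R) * rho X H `^ (2 / n%:R)))%:E)%E.
Proof.
have uH : H \in unitmx by rewrite -row_free_unit /row_free rankH.
have mX := compact_measurable_cV compactX.
have [mHX vHX] := vol_image uH mX.
rewrite /rho; set HX := [set H *m x | x in X] in mHX vHX *.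
have [b b0 Hb] := compact_euclidean_bounded H compactX.
have HXb : HX `<=` euclidean_ball b by move=> _ [x Xx <-]; exact: Hb.
have [r0 HXr] := r_max_le b0 HXb.
set r := r_max HX in r0 HXr *.
have detH : 0 < `|\det H| by rewrite normr_gt0 -unitfE -unitmxE.
have vHX0 : (0 < vol n HX)%E by rewrite vHX mule_gt0// lte_fin.
have vHXr : (vol n HX <= vol n (euclidean_ball (n := n) r))%E.
  by apply: le_measure; rewrite ?inE//; exact: measurable_euclidean_ball.
(* A ball of radius 0 has volume 0 and cannot contain HX. *)
have r_gt0 : 0 < r.
  rewrite lt_neqAle r0 andbT; apply/eqP => r00; move: (lt_le_trans vHX0 vHXr).
  by rewrite -r00 vol_ball0// ltxx.
rewrite (vol_ball _ r_gt0) in vHXr *; set w := unit_ball_vol n in vHXr *.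
have vHXf : vol n HX \is a fin_num.
  by rewrite ge0_fin_numE ?ltW//; exact: le_lt_trans vHXr (ltry _).
set v := fine (vol n HX).
have vE : vol n HX = v%:E by rewrite fineK.
have v0 : 0 < v by move: vHX0; rewrite vE lte_fin.
have vw : v <= w * r ^+ n by move: vHXr; rewrite vE lee_fin.
have w0 : 0 < w.
  by have := lt_le_trans v0 vw; rewrite pmulr_lgt0// exprn_gt0.
(* An infinite volume of X would make that of HX infinite, so [fine] in [C_EPI] does not fall back
   on its default value. *)
have vX : `|\det H| * fine (vol n X) = v.
  move: vHX; rewrite vE; case: (vol n X) volX_gt0 => [t||]// _.
    by rewrite -EFinM => -[].
  by rewrite gt0_muley// lte_fin.
have l2 : 0 < ln 2 :> R by rewrite ln_gt0// ltr1n.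
have nR : 0 < n%:R :> R by rewrite ltr0n.
have CE : C_EPI X H = n%:R / 2 *
    ln (1 + v `^ (2 / n%:R) / (2 * pi * expR 1)) / ln 2.
  rewrite /C_EPI /log2 -vX powRM ?mulrA// fine_ge0//.
rewrite leeBlDr// CE /log2 -EFinD.
have cap : (capacity X H <= ((ln w + (ln (pi * n%:R) +
    n%:R * (ln (r ^+ 2 + n%:R + 2) - ln (2 * pi) - 1)) / 2) / ln 2)%:E)%E.
  apply: ge_ereal_sup => _ [F FX <-].
  apply: (channel_information_le n_gt0 r0 _ w0).
  (* F gives mass 1 to X, so the complement of X is the exceptional null set for the bound on |H
     x|. *)
  exists (~` X); split; first exact: measurableC.
    by rewrite probability_setC// FX subee.
  by move=> x /= xr Xx; apply: xr; apply: HXr; exists x.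
apply: le_trans cap _; rewrite lee_fin ler_pdivrMr//.
apply: le_trans (capacity_bound_le n_gt0 w0 r_gt0 v0 vw (ln_unit_ball_vol_le w0)) _.
by rewrite le_eqVlt; apply/orP; left; apply/eqP; field; rewrite gt_eqF.
Qed.
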